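(* Let $\{A(\lambda),B(\lambda),C(\lambda),D(\lambda)\}$ be a linear system quadruple, with $A(\lambda)\in\mathbb{C}[\lambda]^{d\times d}$ regular, realizing the rational matrix $R(\lambda):=C(\lambda)A(\lambda)^{-1}B(\lambda)+D(\lambda)\in\mathbb{C}(\lambda)^{m\times n}$. Then there exist unitary matrices $U,V\in\mathbb{C}^{d\times d}$ and $\widetilde W\in\mathbb{C}^{(d+n)\times(d+n)}$ such that $$\begin{bmatrix} U & 0\\ 0 & I_m\end{bmatrix}\begin{bmatrix} A(\lambda) & -B(\lambda)\\ C(\lambda) & D(\lambda)\end{bmatrix}\begin{bmatrix} V & 0\\ 0 & I_n\end{bmatrix}\widetilde W=\begin{bmatrix} X_{\overline c}(\lambda) & 0 & 0\\ Y_{\overline c}(\lambda) & A_c(\lambda) & -B_c(\lambda)\\ Z_{\overline c}(\lambda) & C_c(\lambda) & D_c(\lambda)\end{bmatrix},$$ where $\widetilde W$ is of the form $$\widetilde W=\begin{bmatrix} \widetilde W_{11} & 0 & \widetilde W_{13}\\ 0 & I_{d_c} & 0\\ \widetilde W_{31} & 0 & \widetilde W_{33}\end{bmatrix}\in\mathbb{C}^{(d_{\overline c}+d_c+n)\times(d_{\overline c}+d_c+n)},$$ $d_{\overline c}$ is the number of (finite and infinite) eigenvalues of $\begin{bmatrix} A(\lambda) & -B(\lambda)\end{bmatrix}$, $d=d_{\overline c}+d_c$, and $X_{\overline c}(\lambda)\in\mathbb{C}[\lambda]^{d_{\overline c}\times d_{\overline c}}$ is a regular pencil. Moreover: a) the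 eigenvalues of $\begin{bmatrix} A(\lambda) & -B(\lambda)\end{bmatrix}$ are the eigenvalues of $X_{\overline c}(\lambda)$; b) $\begin{bmatrix} A_c(\lambda) & -B_c(\lambda)\end{bmatrix}\in\mathbb{C}[\lambda]^{d_c\times(d_c+n)}$ has no (finite or infinite) eigenvalues; c) the quadruple $\{A_c(\lambda),B_c(\lambda),C_c(\lambda),D_c(\lambda)\}$ is a realization of the transfer function $R_c(\lambda):=R(\lambda)\widetilde W_{33}$, with $\widetilde W_{33}\in\mathbb{C}^{n\times n}$ invertible; d) if $\begin{bmatrix} A(\lambda)\\ C(\lambda)\end{bmatrix}$ has no finite or infinite eigenvalues, then $\begin{bmatrix} A_c(\lambda)\\ C_c(\lambda)\end{bmatrix}$ also has no finite or infinite eigenvalues.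
   Context: A linear system quadruple $\{A(\lambda),B(\lambda),C(\lambda),D(\lambda)\}$ consists of complex matrix pencils (polynomial matrices of the form $\lambda M_1-M_0$) of sizes $d\times d$, $d\times n$, $m\times d$, $m\times n$, respectively, with $A(\lambda)$ regular, i.e. $\det A(\lambda)\not\equiv 0$. It realizes (is a realization of) its transfer function $C(\lambda)A(\lambda)^{-1}B(\lambda)+D(\lambda)$. Eigenvalues are meant in the Kronecker sense, and all pencils are considered as having grade $1$. Every $p\times q$ pencil $P(\lambda)=\lambda P_1-P_0$ of normal rank $r$ (size of the largest not identically zero minor) is strictly equivalent to its Kronecker canonical form $$\mathrm{diag}\left(L_{\eta_1}^T(\lambda),\dots,L_{\eta_{p-r}}^T(\lambda),\ \lambda I_{r_f}-A_J,\ \lambda N-I_{r_\infty},\ L_{\epsilon_1}(\lambda),\dots,L_{\epsilon_{q-r}}(\lambda)\right),$$ with $A_J$ in Jordan form, $N$ nilpotent in Jordan form, and $L_k(\lambda)$ the $k\times(k+1)$ bidiagonal pencil with $\lambda$ on the diagonal and $1$ on the superdiagonal. The finite eigenvalues of $P$ are the $r_f$ eigenvalues of $A_J$, and $P$ has $r_\infty$ infinite eigenvalues. The number of (finite and infinite) eigenvalues is $r_f+r_\infty$ (counted with multiplicity). In particular, $P$ has no finite or infinite eigenvalues if and only if $\operatorname{rank}P(\lambda_0)=r$ for all $\lambda_0\in\mathbb{C}$ and $\operatorname{rank}P_1=r$. In the displayed identity the block partition of the right-hand side has row sizes $d_{\overline c},d_c,m$ and column sizes $d_{\overline c},d_c,n$.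 *)

(* Defs.v *)
(* The complex field is R[i] for an arbitrary R : realType. *)
From HB Require Import structures.
From mathcomp Require Import all_boot all_order all_algebra.
From mathcomp Require Export complex.
From mathcomp Require Export reals.

Set Implicit Arguments.
Unset Strict Implicit.
Unset Printing Implicit Defensive.

Import GRing.Theory.
Local Open Scope ring_scope.

Section BlockMatrices.
Variable R : pzRingType.

Definition block3_mx (p1 p2 p3 q1 q2 q3 : nat)
    (M11 : 'M[R]_(p1, q1)) (M12 : 'M[R]_(p1, q2)) (M13 : 'M[R]_(p1, q3))
    (M21 : 'M[R]_(p2, q1)) (M22 : 'M[R]_(p2, q2)) (M23 : 'M[R]_(p2, q3))
    (M31 : 'M[R]_(p3, q1)) (M32 : 'M[R]_(p3, q2)) (M33 : 'M[R]_(p3, q3)) :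
    'M[R]_(p1 + p2 + p3, q1 + q2 + q3) :=
  block_mx (block_mx M11 M12 M21 M22) (col_mx M13 M23)
           (row_mx M31 M32)           M33.

(* Rectangular block-diagonal matrix; blocks with zero rows or zero columns
   are allowed and do contribute their columns (resp. rows). *)
Fixpoint diag_blocks (T : Type) (p q : T -> nat)
    (M : forall t, 'M[R]_(p t, q t)) (s : seq T) :
    'M[R]_(sumn (map p s), sumn (map q s)) :=
  if s is t :: s' then block_mx (M t) 0 0 (diag_blocks M s') else 0.

End BlockMatrices.

Section Pencils.
Variable F : fieldType.

Definition cst_mx p q (M : 'M[F]_(p, q)) : 'M[{poly F}]_(p, q) :=
  map_mx polyC M.

Definition pencil p q (M1 M0 : 'M[F]_(p, q)) : 'M[{poly F}]_(p, q) :=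
  'X *: cst_mx M1 - cst_mx M0.

Definition is_pencil p q (P : 'M[{poly F}]_(p, q)) : Prop :=
  exists M1 M0 : 'M[F]_(p, q), P = pencil M1 M0.

Definition regular d (P : 'M[{poly F}]_d) : Prop := \det P != 0.

(* The dimensions of P and Q are equal only propositionally in the use below,
   where those of Q are sums of block sizes. *)
Definition strictly_equivalent p q p' q'
    (P : 'M[{poly F}]_(p, q)) (Q : 'M[{poly F}]_(p', q')) : Prop :=
  exists (ep : p' = p) (eq : q' = q) (S : 'M[F]_p) (T : 'M[F]_q),
    [/\ S \in unitmx, T \in unitmx
      & cst_mx S *m P *m cst_mx T = castmx (ep, eq) Q].

Definition L_pencil (k : nat) : 'M[{poly F}]_(k, k.+1) :=
  \matrix_(i, j) (if j == i :> nat then 'X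
                  else if j == i.+1 :> nat then 1 else 0).

Definition jordan_block (a : F) (k : nat) : 'M[F]_k :=
  \matrix_(i, j) (if j == i :> nat then a
                  else if j == i.+1 :> nat then 1 else 0).

(* A pair (a, k) stands for the k x k Jordan block of eigenvalue a. *)
Definition jordan_mx (s : seq (F * nat)) :=
  diag_blocks (p := snd) (q := snd) (fun t => jordan_block t.1 t.2) s.

Definition nilpotent_jordan_mx (s : seq nat) :=
  diag_blocks (p := id) (q := id) (jordan_block 0) s.

(* Block sizes of a Kronecker canonical form: left minimal indices, blocks of
   A_J, sizes of the blocks of N, right minimal indices.  A Jordan block of
   size 0 is an empty matrix and contributes nothing. *)
Record kronecker_data := KroneckerData {
  left_indices : seq nat;
  finite_blocks : seq (F * nat);
  infinite_blocks : seq nat;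
  right_indices : seq nat }.

Definition kcf_AJ (K : kronecker_data) := jordan_mx (finite_blocks K).
Definition kcf_N (K : kronecker_data) := nilpotent_jordan_mx (infinite_blocks K).

Definition kcf_rf (K : kronecker_data) : nat := sumn (map snd (finite_blocks K)).
Definition kcf_rinf (K : kronecker_data) : nat :=
  sumn (map id (infinite_blocks K)).

Definition kcf_mx (K : kronecker_data) :=
  block_mx
    (diag_blocks (p := succn) (q := id) (fun k => (L_pencil k)^T)
                 (left_indices K)) 0
    0 (block_mx
         (pencil 1%:M (kcf_AJ K)) 0
         0 (block_mx
              (pencil (kcf_N K) 1%:M) 0
              0 (diag_blocks (p := id) (q := succn) L_pencil
                             (right_indices K)))).

Definition has_kcf p q (P : 'M[{poly F}]_(p, q)) (K : kronecker_data) : Prop :=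
  strictly_equivalent P (kcf_mx K).

(* P has the finite eigenvalues s, listed with multiplicity in any order, and
   k infinite eigenvalues.  For pencils over an algebraically closed field, the
   existence of the Kronecker canonical form, and its uniqueness up to the order
   of the blocks, make this relation determine s up to permutation, and k. *)
Definition has_eigenvalues p q (P : 'M[{poly F}]_(p, q)) (s : seq F) (k : nat) :
    Prop :=
  exists K : kronecker_data,
    [/\ has_kcf P K, char_poly (kcf_AJ K) = \prod_(z <- s) ('X - z%:P)
      & kcf_rinf K = k].

Definition number_of_eigenvalues p q (P : 'M[{poly F}]_(p, q)) (k : nat) : Prop :=
  exists K : kronecker_data, has_kcf P K /\ k = (kcf_rf K + kcf_rinf K)%N.

Definition no_eigenvalues p q (P : 'M[{poly F}]_(p, q)) : Prop :=
  number_of_eigenvalues P 0.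

Definition same_eigenvalues p q p' q'
    (P : 'M[{poly F}]_(p, q)) (Q : 'M[{poly F}]_(p', q')) : Prop :=
  exists (s : seq F) (k : nat), has_eigenvalues P s k /\ has_eigenvalues Q s k.

Definition linear_system d m n (A : 'M[{poly F}]_d) (B : 'M[{poly F}]_(d, n))
    (C : 'M[{poly F}]_(m, d)) (D : 'M[{poly F}]_(m, n)) : Prop :=
  [/\ is_pencil A, is_pencil B, is_pencil C, is_pencil D & regular A].

Definition rat_mx p q (P : 'M[{poly F}]_(p, q)) :
    'M[{fraction {poly F}}]_(p, q) := map_mx (@tofrac {poly F}) P.

Definition transfer d m n (A : 'M[{poly F}]_d) (B : 'M[{poly F}]_(d, n))
    (C : 'M[{poly F}]_(m, d)) (D : 'M[{poly F}]_(m, n)) :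
    'M[{fraction {poly F}}]_(m, n) :=
  rat_mx C *m invmx (rat_mx A) *m rat_mx B + rat_mx D.

Definition realizes d m n (A : 'M[{poly F}]_d) (B : 'M[{poly F}]_(d, n))
    (C : 'M[{poly F}]_(m, d)) (D : 'M[{poly F}]_(m, n))
    (G : 'M[{fraction {poly F}}]_(m, n)) : Prop :=
  linear_system A B C D /\ transfer A B C D = G.

End Pencils.

(* Main.v *)
Require Import Defs.
From HB Require Import structures.
From mathcomp Require Import all_boot all_order all_algebra.
Set Implicit Arguments.
Unset Strict Implicit.
Unset Printing Implicit Defensive.
Import GRing.Theory.
Local Open Scope ring_scope.
Local Open Scope complex_scope.

(** Write P for the pencil [A, -B], of full row normal rank because A is regular.
    The theorem is an orthogonalized version of the Kronecker decomposition of P,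
    in which L_eps blocks and a square regular pencil are the only summands.

    Existence of that decomposition is built in two stages.  kronecker_splitting
    shows that a pencil of full row normal rank is strictly equivalent to
    diag(X, L_eps1, L_eps2, ...) with X square, by induction on the number of
    columns: rows where the leading coefficient vanishes are split off into X, and
    when the leading coefficient has full row rank the rows through which the
    remaining constant columns act are split off, which lengthens every L_eps by
    one.  weierstrass_form then brings the regular X to diag(lambda I - J,
    lambda N - I): at a point mu where X is invertible X amounts to a single matrix
    M, and M loses its Jordan blocks one at a time.

    So S P T = diag(X, Q), where Q is a sum of L blocks.  Gram-Schmidt writes S and
    T^-1 as (block lower triangular) times (unitary), which leaves
    U P W0 = [X' 0; Y' Q'] with U, W0 unitary and X', Q' strictly equivalent to X,
    Q; the assertions on the eigenvalues of X' and of Q' are then immediate.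
    It remains to factor W0, up to a unitary mixing of the columns facing Q', as
    diag(V, I) W with W having the identity as middle block
    (unitary_special_form): since only r columns of W0 face X', where r is the size
    of X', there are d - r orthonormal rows that annihilate the upper part of these
    columns, and they serve as the last rows of V^*.  Comparing columns gives
    U A V = [* 0; * Ac], so Ac is regular and W33 invertible, and the formula for
    the transfer function is an identity of block elimination.  The columns of
    [Ac; Cc] are images of columns of [A; C], so a kernel vector of the former at a
    point of the projective line gives one of the latter.  Among pencils of full
    column normal rank those without eigenvalues are the ones of full rank at all
    points, by the decomposition of the transposed pencil, which proves the last
    assertion. *)

(** * Strict equivalence of coefficient pairs *)

Section PairEquivalence.
Variable F : fieldType.

(** Transformations are kept rectangular, the equality of their two sizes being a
    consequence; block sums and permutations of blocks then need no casts. *)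
Definition two_sided_inverse a b (S : 'M[F]_(a, b)) (S' : 'M[F]_(b, a)) : Prop :=
  S *m S' = 1%:M /\ S' *m S = 1%:M.

Lemma two_sided_inverse_size a b (S : 'M[F]_(a, b)) S' :
  two_sided_inverse S S' -> a = b.
Proof.
by case=> e1 e2; apply/eqP; rewrite eqn_leq (mulmx1_min e1) (mulmx1_min e2).
Qed.

Lemma two_sided_inverse1 a : two_sided_inverse (1%:M : 'M[F]_a) 1%:M.
Proof. by split; rewrite mulmx1. Qed.

Lemma two_sided_inverse_sym a b (S : 'M[F]_(a, b)) S' :
  two_sided_inverse S S' -> two_sided_inverse S' S.
Proof. by case. Qed.

Lemma two_sided_inverseM a b c (S : 'M[F]_(a, b)) S' (T : 'M[F]_(b, c)) T' :
  two_sided_inverse S S' -> two_sided_inverse T T' ->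
  two_sided_inverse (S *m T) (T' *m S').
Proof.
move=> [e1 e2] [f1 f2]; split; rewrite mulmxA.
  by rewrite -(mulmxA S) f1 mulmx1.
by rewrite -(mulmxA T') e2 mulmx1.
Qed.

Lemma two_sided_inverse_diag a b c d (S : 'M[F]_(a, b)) S' (T : 'M[F]_(c, d)) T' :
  two_sided_inverse S S' -> two_sided_inverse T T' ->
  two_sided_inverse (block_mx S 0 0 T) (block_mx S' 0 0 T').
Proof.
move=> [e1 e2] [f1 f2]; rewrite /two_sided_inverse !mulmx_block.
by rewrite !mulmx0 !mul0mx !addr0 !add0r e1 e2 f1 f2 -!scalar_mx_block.
Qed.

Lemma two_sided_inverse_unit a (S : 'M[F]_a) :
  S \in unitmx -> two_sided_inverse S (invmx S).
Proof. by move=> uS; split; rewrite ?mulmxV ?mulVmx. Qed.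

Lemma two_sided_inverse_unitP a (S S' : 'M[F]_a) :
  two_sided_inverse S S' -> S \in unitmx.
Proof. by case=> e _; case/mulmx1_unit: e. Qed.

Lemma two_sided_inverse_lower a b (z : 'M[F]_(b, a)) :
  two_sided_inverse (block_mx 1%:M 0 z 1%:M) (block_mx 1%:M 0 (- z) 1%:M).
Proof.
rewrite /two_sided_inverse !mulmx_block !(mulmx0, mul0mx, mulmx1, mul1mx).
by rewrite !(addr0, add0r) subrr addNr -!scalar_mx_block.
Qed.

(** The pair (M1, M0) stands for the pencil lambda M1 - M0; packing the sizes makes
    block sums a commutative monoid up to equivalence. *)
Record cpair := CPair {
  height : nat;
  width : nat;
  lead : 'M[F]_(height, width);
  tail : 'M[F]_(height, width) }.

Definition pequiv (P Q : cpair) : Prop :=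
  exists S S' T T',
    [/\ two_sided_inverse S S', two_sided_inverse T T',
        S *m lead P *m T = lead Q & S *m tail P *m T = tail Q].

Local Infix "~~~" := pequiv (at level 70).

Lemma pequiv_refl P : P ~~~ P.
Proof.
exists 1%:M, 1%:M, 1%:M, 1%:M.
by split; rewrite ?mulmx1 ?mul1mx //; apply: two_sided_inverse1.
Qed.

Lemma pequiv_sym P Q : P ~~~ Q -> Q ~~~ P.
Proof.
move=> [S [S' [T [T' [iS iT eL eT]]]]].
exists S', S, T', T; split; try exact: two_sided_inverse_sym.
  by rewrite -eL !mulmxA iS.2 mul1mx -mulmxA iT.1 mulmx1.
by rewrite -eT !mulmxA iS.2 mul1mx -mulmxA iT.1 mulmx1.
Qed.

Lemma pequiv_trans Q P N : P ~~~ Q -> Q ~~~ N -> P ~~~ N.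
Proof.
move=> [S [S' [T [T' [iS iT eL eT]]]]] [X [X' [Y [Y' [iX iY fL fT]]]]].
exists (X *m S), (S' *m X'), (T *m Y), (Y' *m T').
split; try exact: two_sided_inverseM.
  by rewrite -fL -eL !mulmxA.
by rewrite -fT -eT !mulmxA.
Qed.

Lemma pequiv_size P Q : P ~~~ Q -> height P = height Q /\ width P = width Q.
Proof.
move=> [S [S' [T [T' [iS iT _ _]]]]]; split.
  exact/esym/(two_sided_inverse_size iS).
exact: (two_sided_inverse_size iT).
Qed.

Lemma pequiv_cast a b a' b' (e : (a = a') * (b = b')) (M1 M0 : 'M[F]_(a, b)) :
  CPair M1 M0 ~~~ CPair (castmx e M1) (castmx e M0).
Proof.
case: e => e f; case: a' / e; case: b' / f.
by rewrite !castmx_id; apply: pequiv_refl.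
Qed.

Definition dsum (P Q : cpair) : cpair :=
  CPair (block_mx (lead P) 0 0 (lead Q)) (block_mx (tail P) 0 0 (tail Q)).

Lemma pequiv_dsum P P' Q Q' : P ~~~ P' -> Q ~~~ Q' -> dsum P Q ~~~ dsum P' Q'.
Proof.
move=> [S [S' [T [T' [iS iT eL eT]]]]] [X [X' [Y [Y' [iX iY fL fT]]]]].
exists (block_mx S 0 0 X), (block_mx S' 0 0 X').
exists (block_mx T 0 0 Y), (block_mx T' 0 0 Y').
split; try exact: two_sided_inverse_diag.
  by rewrite /= !mulmx_block !(mulmx0, mul0mx, addr0, add0r) eL fL.
by rewrite /= !mulmx_block !(mulmx0, mul0mx, addr0, add0r) eT fT.
Qed.

Lemma two_sided_inverse_swap a b :
  two_sided_inverse (block_mx 0 1%:M 1%:M 0 : 'M[F]_(a + b, b + a))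
                    (block_mx 0 1%:M 1%:M 0).
Proof.
rewrite /two_sided_inverse !mulmx_block !(mulmx0, mul0mx, mulmx1).
by rewrite !(addr0, add0r) -!scalar_mx_block.
Qed.

Lemma pequiv_swap a b c d (A1 A0 : 'M[F]_(a, c)) (B1 B0 : 'M[F]_(a, d))
    (C1 C0 : 'M[F]_(b, c)) (D1 D0 : 'M[F]_(b, d)) :
  CPair (block_mx A1 B1 C1 D1) (block_mx A0 B0 C0 D0)
    ~~~ CPair (block_mx D1 C1 B1 A1) (block_mx D0 C0 B0 A0).
Proof.
exists (block_mx 0 1%:M 1%:M 0), (block_mx 0 1%:M 1%:M 0).
exists (block_mx 0 1%:M 1%:M 0), (block_mx 0 1%:M 1%:M 0).
split; try exact: two_sided_inverse_swap;
  by rewrite /= !mulmx_block !(mulmx0, mul0mx, mul1mx, mulmx1, addr0, add0r).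
Qed.

Lemma dsumC P Q : dsum P Q ~~~ dsum Q P.
Proof. exact: pequiv_swap. Qed.

Lemma pequiv_blockA m1 m2 m3 n1 n2 n3
    (A11 B11 : 'M[F]_(m1, n1)) (A12 B12 : 'M[F]_(m1, n2)) (A13 B13 : 'M[F]_(m1, n3))
    (A21 B21 : 'M[F]_(m2, n1)) (A22 B22 : 'M[F]_(m2, n2)) (A23 B23 : 'M[F]_(m2, n3))
    (A31 B31 : 'M[F]_(m3, n1)) (A32 B32 : 'M[F]_(m3, n2)) (A33 B33 : 'M[F]_(m3, n3)) :
  CPair (block_mx A11 (row_mx A12 A13) (col_mx A21 A31) (block_mx A22 A23 A32 A33))
       (block_mx B11 (row_mx B12 B13) (col_mx B21 B31) (block_mx B22 B23 B32 B33))
  ~~~ CPair (block3_mx A11 A12 A13 A21 A22 A23 A31 A32 A33)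
           (block3_mx B11 B12 B13 B21 B22 B23 B31 B32 B33).
Proof. by rewrite 2!block_mxA; apply/pequiv_sym/pequiv_cast. Qed.

Lemma dsumA P Q N : dsum P (dsum Q N) ~~~ dsum (dsum P Q) N.
Proof.
have := @pequiv_blockA _ _ _ _ _ _ (lead P) (tail P) 0 0 0 0 0 0 (lead Q) (tail Q)
  0 0 0 0 0 0 (lead N) (tail N).
by rewrite /block3_mx !row_mx0 !col_mx0.
Qed.

Lemma dsumCA P Q N : dsum P (dsum Q N) ~~~ dsum Q (dsum P N).
Proof.
apply: pequiv_trans (dsumA _ _ _) _; apply: pequiv_trans _ (pequiv_sym (dsumA _ _ _)).
by apply: pequiv_dsum (pequiv_refl _); apply: dsumC.
Qed.

Lemma pequiv_flat0 a (M1 M0 : 'M[F]_(0, a)) (N1 N0 : 'M[F]_(0, a)) :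
  CPair M1 M0 ~~~ CPair N1 N0.
Proof.
by rewrite (flatmx0 M1) (flatmx0 M0) (flatmx0 N1) (flatmx0 N0); apply: pequiv_refl.
Qed.

Definition null_cpair : cpair := CPair (0 : 'M[F]_(0, 0)) 0.

Lemma dsum0p P : dsum null_cpair P ~~~ P.
Proof.
exists (row_mx 0 1%:M), (col_mx 0 1%:M), (col_mx 0 1%:M), (row_mx 0 1%:M).
have invk k : two_sided_inverse (row_mx 0 1%:M : 'M[F]_(k, 0 + k)) (col_mx 0 1%:M).
  split; first by rewrite mul_row_col mulmx1 mul0mx add0r.
  rewrite mul_col_row !(mulmx0, mul0mx, mulmx1).
  by rewrite [RHS]scalar_mx_block; congr block_mx; rewrite [RHS]flatmx0.
have invk' k := two_sided_inverse_sym (invk k).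
split; [exact: invk | exact: invk' | |] => /=.
  by rewrite mul_row_block mul_row_col !(mul0mx, mul1mx, mulmx1, mulmx0, add0r).
by rewrite mul_row_block mul_row_col !(mul0mx, mul1mx, mulmx1, mulmx0, add0r).
Qed.

Lemma dsump0 P : dsum P null_cpair ~~~ P.
Proof. exact: pequiv_trans (dsumC _ _) (dsum0p P). Qed.

(** Moving the second row and column groups past the third turns a block matrix of
    diagonal blocks into a direct sum; it is used to distribute rows and columns
    appended to a direct sum over its summands. *)
Lemma pequiv_interleave p1 p2 p3 p4 q1 q2 q3 q4
   (A1 A0 : 'M[F]_(p1, q1)) (A1' A0' : 'M[F]_(p2, q2))
   (B1 B0 : 'M[F]_(p1, q3)) (B1' B0' : 'M[F]_(p2, q4))
   (C1 C0 : 'M[F]_(p3, q1)) (C1' C0' : 'M[F]_(p4, q2))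
   (D1 D0 : 'M[F]_(p3, q3)) (D1' D0' : 'M[F]_(p4, q4)) :
  CPair (block_mx (block_mx A1 0 0 A1') (block_mx B1 0 0 B1')
                 (block_mx C1 0 0 C1') (block_mx D1 0 0 D1'))
       (block_mx (block_mx A0 0 0 A0') (block_mx B0 0 0 B0')
                 (block_mx C0 0 0 C0') (block_mx D0 0 0 D0'))
  ~~~ dsum (CPair (block_mx A1 B1 C1 D1) (block_mx A0 B0 C0 D0))
           (CPair (block_mx A1' B1' C1' D1') (block_mx A0' B0' C0' D0')).
Proof.
pose X a b c d := block_mx (block_mx 1%:M 0 0 0) (block_mx 0 0 1%:M 0)
  (block_mx 0 1%:M 0 0) (block_mx 0 0 0 1%:M) : 'M[F]_((a + b) + (c + d), (a + c) + (b + d)).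
have invX a b c d : two_sided_inverse (X a b c d) (X a c b d).
  split; rewrite /X !mulmx_block !(mulmx0, mul0mx, mulmx1, addr0, add0r).
    by rewrite !add_block_mx !(addr0, add0r) !block_mx0 -!scalar_mx_block.
  by rewrite !add_block_mx !(addr0, add0r) !block_mx0 -!scalar_mx_block.
exists (X p1 p3 p2 p4), (X p1 p2 p3 p4), (X q1 q2 q3 q4), (X q1 q3 q2 q4).
have mx_simp := (mulmx0, mul0mx, mul1mx, mulmx1, addr0, add0r).
split; [exact: invX | exact: invX | |];
  by rewrite /X /= !(mulmx_block, mx_simp) !add_block_mx !(mulmx_block, mx_simp)
             !add_block_mx !mx_simp ?block_mx0.
Qed.

End PairEquivalence.
Arguments null_cpair {F}.

Local Infix "~~~" := pequiv (at level 70).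

(** * Pencils as polynomial matrices *)

Section PencilAlgebra.
Variable F : fieldType.

Lemma cst_mxM p q t (M : 'M[F]_(p, q)) (N : 'M[F]_(q, t)) :
  cst_mx (M *m N) = cst_mx M *m cst_mx N.
Proof. exact: map_mxM. Qed.

Lemma cst_mx1 p : cst_mx (1%:M : 'M[F]_p) = 1%:M.
Proof. exact: map_mx1. Qed.

Lemma cst_mx0 p q : cst_mx (0 : 'M[F]_(p, q)) = 0.
Proof. exact: map_mx0. Qed.

Lemma cst_mx_inj p q : injective (@cst_mx F p q).
Proof.
by move=> M N /matrixP e; apply/matrixP=> i j; apply: polyC_inj; move: (e i j); rewrite !mxE.
Qed.

Lemma pencil00 p q : pencil (0 : 'M[F]_(p, q)) 0 = 0.
Proof. by rewrite /pencil cst_mx0 scaler0 subr0. Qed.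

Lemma pencil01 p : pencil (0 : 'M[F]_p) 1%:M = - 1%:M.
Proof. by rewrite /pencil cst_mx0 cst_mx1 scaler0 sub0r. Qed.

Lemma pencil_block p1 p2 q1 q2 (A1 A0 : 'M[F]_(p1, q1)) (B1 B0 : 'M[F]_(p1, q2))
    (C1 C0 : 'M[F]_(p2, q1)) (D1 D0 : 'M[F]_(p2, q2)) :
  pencil (block_mx A1 B1 C1 D1) (block_mx A0 B0 C0 D0) =
  block_mx (pencil A1 A0) (pencil B1 B0) (pencil C1 C0) (pencil D1 D0).
Proof.
by rewrite /pencil /cst_mx !map_block_mx scale_block_mx opp_block_mx add_block_mx.
Qed.

Lemma pencil_row p q1 q2 (A1 A0 : 'M[F]_(p, q1)) (B1 B0 : 'M[F]_(p, q2)) :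
  pencil (row_mx A1 B1) (row_mx A0 B0) = row_mx (pencil A1 A0) (pencil B1 B0).
Proof.
by rewrite /pencil /cst_mx !map_row_mx scale_row_mx opp_row_mx add_row_mx.
Qed.

Lemma pencil_col p1 p2 q (A1 A0 : 'M[F]_(p1, q)) (B1 B0 : 'M[F]_(p2, q)) :
  pencil (col_mx A1 B1) (col_mx A0 B0) = col_mx (pencil A1 A0) (pencil B1 B0).
Proof.
by rewrite /pencil /cst_mx !map_col_mx scale_col_mx opp_col_mx add_col_mx.
Qed.

Lemma pencil_mul p q p' q' (S : 'M[F]_(p', p)) (T : 'M[F]_(q, q'))
    (M1 M0 : 'M[F]_(p, q)) :
  cst_mx S *m pencil M1 M0 *m cst_mx T = pencil (S *m M1 *m T) (S *m M0 *m T).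
Proof.
rewrite /pencil mulmxBr mulmxBl -scalemxAr -scalemxAl.
by rewrite !cst_mxM.
Qed.

Lemma pencil_mulr p q q' (T : 'M[F]_(q, q')) (M1 M0 : 'M[F]_(p, q)) :
  pencil M1 M0 *m cst_mx T = pencil (M1 *m T) (M0 *m T).
Proof. by rewrite /pencil mulmxBl -scalemxAl !cst_mxM. Qed.

Lemma pencil_mull p q p' (S : 'M[F]_(p', p)) (M1 M0 : 'M[F]_(p, q)) :
  cst_mx S *m pencil M1 M0 = pencil (S *m M1) (S *m M0).
Proof. by rewrite /pencil mulmxBr -scalemxAr !cst_mxM. Qed.

Lemma pencil_inj p q (M1 M0 N1 N0 : 'M[F]_(p, q)) :
  pencil M1 M0 = pencil N1 N0 -> M1 = N1 /\ M0 = N0.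
Proof.
move=> e; have eP i j : (pencil M1 M0) i j = (pencil N1 N0) i j by rewrite e.
split; apply/matrixP=> i j; move: (eP i j); rewrite !mxE => /polyP eq.
  by have := eq 1%N; rewrite !(coefB, coefXM, coefC) /= !subr0.
by have := eq 0%N; rewrite !(coefB, coefXM, coefC) /= !sub0r => /oppr_inj.
Qed.

Lemma tr_pencil p q (M1 M0 : 'M[F]_(p, q)) : (pencil M1 M0)^T = pencil M1^T M0^T.
Proof. by apply/matrixP=> i j; rewrite !mxE. Qed.

(** Full row normal rank, expressed without passing to rational functions. *)
Definition row_injective (P : cpair F) : Prop :=
  forall v : 'rV[{poly F}]_(height P), v *m pencil (lead P) (tail P) = 0 -> v = 0.

Lemma pequiv_row_injective P Q : P ~~~ Q -> row_injective P -> row_injective Q.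
Proof.
move=> [S [S' [T [T' [[S1 S2] [T1 T2] eL eT]]]]] injP v.
rewrite -eL -eT -pencil_mul !mulmxA => /(congr1 (fun z => z *m cst_mx T')).
rewrite mul0mx -(mulmxA _ (cst_mx T)) -cst_mxM T1 cst_mx1 mulmx1.
move/injP/(congr1 (fun z => z *m cst_mx S')).
by rewrite mul0mx -mulmxA -cst_mxM S1 cst_mx1 mulmx1.
Qed.

Lemma row_free_completion h p (U : 'M[F]_(h, p)) : row_free U ->
  exists h' (U2 : 'M[F]_(h', p)) S, two_sided_inverse (col_mx U U2) S.
Proof.
move=> fU; exists (\rank (U^C)%MS), (row_base (U^C)%MS).
set M := col_mx _ _.
have MP : (M :=: U + U^C)%MS.
  by apply: eqmx_trans (eqmx_sym (addsmxE _ _)) _;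
     apply: adds_eqmx (eqmx_refl _) (eq_row_base _).
have full : row_full M.
  by rewrite /row_full MP; apply: addsmx_compl_full.
have free : row_free M.
  rewrite /row_free; move: full; rewrite /row_full => /eqP ->.
  rewrite mxrank_compl (eqP fU) addnC subnK //.
  by rewrite -{1}(eqP fU) rank_leq_col.
case/row_fullP: (full) => B eB; case/row_freeP: (free) => D eD.
exists D; split=> //; suff -> : D = B by [].
by rewrite -(mul1mx D) -eB -mulmxA eD mulmx1.
Qed.

Lemma row_free_normal_form h p (U : 'M[F]_(h, p)) : row_free U ->
  exists p' (T : 'M[F]_(p, h + p')) T',
    two_sided_inverse T T' /\ U *m T = row_mx 1%:M 0.
Proof.
case/row_free_completion=> p' [U2 [T iT]]; exists p', T, (col_mx U U2).
split; first exact: two_sided_inverse_sym.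
case: iT; rewrite mul_col_mx scalar_mx_block block_mxEv => /eq_col_mx[-> _] _.
by [].
Qed.

(** The identity block sits in the lower left corner with a minus sign because this
    is how the constant entry 1 of an L block enters the pair (M1, M0) once a row
    and a column are appended to a shorter L block. *)
Lemma rank_normal_form p q (B : 'M[F]_(p, q)) :
  exists p' h b (S : 'M[F]_(p' + h, p)) S' (T : 'M[F]_(q, h + b)) T',
    [/\ two_sided_inverse S S', two_sided_inverse T T'
      & S *m B *m T = block_mx 0 0 (- 1%:M) 0].
Proof.
have [b [T [T' [iT eT]]]] := row_free_normal_form (row_base_free B).
have fC : row_free (col_base B)^T.
  by rewrite /row_free mxrank_tr; apply: col_base_full.
have [p' [S [S' [[iS1 iS2] eS]]]] := row_free_normal_form fC.
have := two_sided_inverse_swap F p' (\rank B).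
set W := block_mx _ _ _ _; set W' := block_mx _ _ _ _ => iW.
exists p', (\rank B), b, (- (W *m S^T)), (- (S'^T *m W')), T, T'; split=> //.
  have iS : two_sided_inverse S^T S'^T.
    by split; rewrite -trmx_mul ?iS1 ?iS2 trmx1.
  by have [e1 e2] := two_sided_inverseM iW iS; split; rewrite mulmxN mulNmx opprK.
transitivity (- (W *m S^T) *m (col_base B *m row_base B) *m T).
  by rewrite mulmx_base.
rewrite mulmxA -mulmxA eT mulNmx -mulmxA.
rewrite -[S^T *m _]trmxK trmx_mul trmxK eS tr_row_mx trmx1 trmx0.
rewrite /W mul_block_col mulNmx mul_col_row !(mulmx0, mul0mx, mulmx1, mul1mx, addr0, add0r).
by rewrite opp_block_mx !oppr0.
Qed.

Lemma pequiv_zero_columns p q b (M1 M0 : 'M[F]_(p, q)) :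
  CPair (row_mx M1 (0 : 'M_(p, b))) (row_mx M0 0) ~~~
  dsum (CPair M1 M0) (CPair (0 : 'M_(0, b)) 0).
Proof.
exists (col_mx 1%:M 0), (row_mx 1%:M 0), 1%:M, 1%:M; split=> //=.
- split; last by rewrite mul_row_col mulmx1 mul0mx addr0.
  rewrite mul_col_row !(mulmx0, mul0mx, mulmx1) [RHS]scalar_mx_block.
  by congr block_mx; rewrite [RHS]flatmx0.
- exact: two_sided_inverse1.
- by rewrite mulmx1 mul_col_row !(mul1mx, mul0mx).
- by rewrite mulmx1 mul_col_row !(mul1mx, mul0mx).
Qed.

End PencilAlgebra.

(** * Sums of L blocks *)

Section DiagBlocks.
Variable F : fieldType.

Lemma diag_blocksM (T : Type) (p q t : T -> nat) (M : forall x, 'M[F]_(p x, q x))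
    (N : forall x, 'M[F]_(q x, t x)) s :
  diag_blocks M s *m diag_blocks N s = diag_blocks (fun x => M x *m N x) s.
Proof.
elim: s => [|x s IH] /=; first by rewrite mul0mx.
by rewrite mulmx_block !(mulmx0, mul0mx, addr0, add0r) IH.
Qed.

Lemma diag_blocksD (T : Type) (p q : T -> nat) (M N : forall x, 'M[F]_(p x, q x)) s :
  diag_blocks M s + diag_blocks N s = diag_blocks (fun x => M x + N x) s.
Proof.
elim: s => [|x s IH] /=; first by rewrite addr0.
by rewrite add_block_mx !addr0 IH.
Qed.

Lemma tr_diag_blocks (R : pzRingType) (T : Type) (p q : T -> nat)
    (M : forall x, 'M[R]_(p x, q x)) s :
  (diag_blocks M s)^T = diag_blocks (fun x => (M x)^T) s.
Proof.
elim: s => [|x s IH] /=; first by rewrite trmx0.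
by rewrite tr_block_mx !trmx0 IH.
Qed.

Lemma eq_diag_blocks (R : pzRingType) (T : Type) (p q : T -> nat)
    (M N : forall x, 'M[R]_(p x, q x)) s :
  (forall x, M x = N x) -> diag_blocks M s = diag_blocks N s.
Proof. by move=> eMN; elim: s => [|x s IH] //=; rewrite eMN IH. Qed.

Lemma diag_blocks0 (T : Type) (p q : T -> nat) s :
  diag_blocks (fun x => 0 : 'M[F]_(p x, q x)) s = 0.
Proof. by elim: s => [|x s IH] //=; rewrite IH block_mx0. Qed.

Lemma diag_blocks1 (T : Type) (p : T -> nat) s :
  diag_blocks (fun x => 1%:M : 'M[F]_(p x)) s = 1%:M.
Proof.
elim: s => [|x s IH] /=; first by rewrite [RHS]flatmx0.
by rewrite IH -scalar_mx_block.
Qed.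

Lemma diag_blocks_pencil (T : Type) (p q : T -> nat)
    (M1 M0 : forall x, 'M[F]_(p x, q x)) s :
  diag_blocks (fun x => pencil (M1 x) (M0 x)) s =
  pencil (diag_blocks M1 s) (diag_blocks M0 s).
Proof.
elim: s => [|x s IH] /=; first by rewrite pencil00.
by rewrite pencil_block !pencil00 IH.
Qed.

Definition L_lead k : 'M[F]_(k, k.+1) := \matrix_(i, j) (j == i :> nat)%:R.
Definition L_tail k : 'M[F]_(k, k.+1) := \matrix_(i, j) - (j == i.+1 :> nat)%:R.
Definition last_row k : 'M[F]_(1, k.+1) := \matrix_(i, j) (j == k :> nat)%:R.

Lemma L_pencilE k : L_pencil F k = pencil (L_lead k) (L_tail k).
Proof.
apply/matrixP=> i j; rewrite !mxE.
case: eqP => [->|_]; last by rewrite mulr0 sub0r polyCN opprK; case: eqP.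
by rewrite ltn_eqF // oppr0 subr0 mulr1.
Qed.

Definition L_sum s : cpair F :=
  CPair (diag_blocks (p := id) (q := succn) L_lead s)
       (diag_blocks (p := id) (q := succn) L_tail s).

(** Together with the leading coefficient of a sum of L blocks these rows form a
    permutation matrix: they pick the columns in which that coefficient is zero. *)
Definition last_rows s :=
  diag_blocks (p := fun _ : nat => 1%N) (q := succn) last_row s.

Lemma sum_eq_nat n (f : nat -> F) a :
  \sum_(i < n) (i == a :> nat)%:R * f i = (a < n)%:R * f a.
Proof.
case: (ltnP a n) => [lt|le].
  rewrite mul1r (bigD1 (Ordinal lt)) //= eqxx mul1r big1 ?addr0 // => i ne.
  by rewrite (negbTE (_ : (i != a :> nat))) ?mul0r.
by rewrite mul0r big1 // => i _; rewrite ltn_eqF ?mul0r // (leq_trans (ltn_ord i)).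
Qed.

Lemma L_leadK k : L_lead k *m (L_lead k)^T = 1%:M.
Proof.
apply/matrixP=> i j; rewrite !mxE.
under eq_bigr do rewrite !mxE.
by rewrite (sum_eq_nat _ (fun l => (l == j)%:R)) ltnS ltnW // mul1r.
Qed.

Lemma last_rowK k : last_row k *m (last_row k)^T = 1%:M.
Proof.
apply/matrixP=> i j; rewrite !mxE.
under eq_bigr do rewrite !mxE.
by rewrite (sum_eq_nat _ (fun l => (l == k)%:R)) ltnS leqnn mul1r eqxx !ord1.
Qed.

Lemma L_lead_last k : L_lead k *m (last_row k)^T = 0.
Proof.
apply/matrixP=> i j; rewrite !mxE.
under eq_bigr do rewrite !mxE.
by rewrite (sum_eq_nat _ (fun l => (l == k)%:R)) ltn_eqF // mulr0.
Qed.

Lemma L_lead_split k :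
  (L_lead k)^T *m L_lead k + (last_row k)^T *m last_row k = 1%:M.
Proof.
apply/matrixP=> i j; rewrite !mxE.
under eq_bigr do rewrite !mxE eq_sym.
rewrite (sum_eq_nat _ (fun l => (j == l :> nat)%:R)) big_ord1 !mxE.
have := ltn_ord i; rewrite ltnS leq_eqVlt => /orP[/eqP ei|lt].
  by rewrite ei ltnn eqxx mul0r add0r mul1r eq_sym -val_eqE /= ei.
by rewrite lt (ltn_eqF lt) mul0r addr0 mul1r eq_sym -val_eqE.
Qed.

Lemma L_sum_leadK s : lead (L_sum s) *m (lead (L_sum s))^T = 1%:M.
Proof.
rewrite /= tr_diag_blocks diag_blocksM (eq_diag_blocks _ L_leadK).
exact: (diag_blocks1 id).
Qed.

Lemma last_rowsK s : last_rows s *m (last_rows s)^T = 1%:M.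
Proof.
rewrite /last_rows tr_diag_blocks diag_blocksM (eq_diag_blocks _ last_rowK).
exact: (diag_blocks1 (fun=> 1%N)).
Qed.

Lemma L_sum_lead_last s : lead (L_sum s) *m (last_rows s)^T = 0.
Proof.
rewrite /= /last_rows tr_diag_blocks diag_blocksM (eq_diag_blocks _ L_lead_last).
exact: (diag_blocks0 id (fun=> 1%N)).
Qed.

Lemma L_sum_lead_split s :
  (lead (L_sum s))^T *m lead (L_sum s) + (last_rows s)^T *m last_rows s = 1%:M.
Proof.
rewrite /= /last_rows !tr_diag_blocks !diag_blocksM diag_blocksD.
by rewrite (eq_diag_blocks _ L_lead_split); apply: (diag_blocks1 succn).
Qed.

Lemma pequiv_L_succ k :
  CPair (block_mx (L_lead k) 0 (last_row k) (0 : 'M_1))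
       (block_mx (L_tail k) 0 0 (- 1%:M))
  ~~~ CPair (L_lead k.+1) (L_tail k.+1).
Proof.
have := pequiv_cast (addn1 k, addn1 k.+1) (block_mx (L_lead k) 0 (last_row k) 0)
       (block_mx (L_tail k) 0 0 (- 1%:M)).
set M1 := castmx _ _; set M0 := castmx _ _.
suff [-> ->] : M1 = L_lead k.+1 /\ M0 = L_tail k.+1 by [].
split; apply/matrixP=> i j; rewrite castmxE /= !mxE.
  case: splitP => i' /= ei; rewrite !mxE; case: splitP => j' /= ej; rewrite !mxE ei ej //.
  - by rewrite ord1 addn0 gtn_eqF // ltnS ltnW.
  - by rewrite !ord1 !addn0.
  - by rewrite !ord1 !addn0 gtn_eqF.
case: splitP => i' /= ei; rewrite !mxE; case: splitP => j' /= ej; rewrite !mxE ei ej //.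
- by rewrite (ord1 j') addn0 eqSS gtn_eqF ?oppr0.
- by rewrite (ord1 i') addn0 ltn_eqF ?oppr0 // ltnS ltnW.
- by rewrite !ord1 !addn0 !eqxx.
Qed.

(** Each block gains the row (0, ..., 0, lambda, 1): its leading part is the last row
    of the old columns and its constant part lies in a new column. *)
Definition L_extension s : cpair F :=
  CPair (block_mx (lead (L_sum s)) 0 (last_rows s) 0)
       (block_mx (tail (L_sum s)) 0 0 (- 1%:M)).

Lemma pequiv_L_extension s : L_extension s ~~~ L_sum (map succn s).
Proof.
elim: s => [|k s IH]; first exact: pequiv_flat0.
apply: pequiv_trans _ (pequiv_dsum (pequiv_L_succ k) IH).
apply: pequiv_trans _ (pequiv_interleave _ _ _ _ _ _ _ _ _ _ _ _ _ _ _ _).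
have e : block_mx (- 1%:M) 0 0 (- 1%:M) = - 1%:M
    :> 'M[F]_(1 + sumn (map (fun=> 1%N) s)).
  by rewrite scalar_mx_block opp_block_mx !oppr0.
by rewrite e !block_mx0; apply: pequiv_refl.
Qed.

Lemma pequiv_L_zeros b s :
  dsum (CPair (0 : 'M_(0, b)) 0) (L_sum s) ~~~ L_sum (nseq b 0%N ++ s).
Proof.
elim: b => [|b IH]; first exact: dsum0p.
apply: pequiv_trans _ (pequiv_dsum (pequiv_refl (CPair (L_lead 0) (L_tail 0))) IH).
apply: pequiv_trans _ (pequiv_sym (dsumA _ _ _)).
by apply: pequiv_dsum (pequiv_refl _); apply: pequiv_flat0.
Qed.

End DiagBlocks.
Arguments L_sum {F} s.
Arguments last_rows {F} s.

(** * Splitting a pencil into a square part and L blocks *)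

Section KroneckerReduction.
Variable F : fieldType.
Let mx_simp := (mulmx0, mul0mx, mul1mx, mulmx1, addr0, add0r).

Lemma pequiv_mul p q p' q' (S : 'M[F]_(p', p)) S' (T : 'M[F]_(q, q')) T'
    (M1 M0 : 'M[F]_(p, q)) :
  two_sided_inverse S S' -> two_sided_inverse T T' ->
  CPair M1 M0 ~~~ CPair (S *m M1 *m T) (S *m M0 *m T).
Proof. by move=> iS iT; exists S, S', T, T'; split. Qed.

Lemma pequiv_add_rows p1 p2 q (Z : 'M[F]_(p2, p1)) (A1 A0 : 'M[F]_(p1, q))
    (B1 B0 : 'M[F]_(p2, q)) :
  CPair (col_mx A1 B1) (col_mx A0 B0) ~~~
  CPair (col_mx A1 (Z *m A1 + B1)) (col_mx A0 (Z *m A0 + B0)).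
Proof.
have := pequiv_mul (col_mx A1 B1) (col_mx A0 B0)
  (two_sided_inverse_lower Z) (two_sided_inverse1 F q).
by rewrite !mul_block_col !mx_simp.
Qed.

Lemma pequiv_add_columns p q1 q2 (Z : 'M[F]_(q2, q1)) (A1 A0 : 'M[F]_(p, q1))
    (B1 B0 : 'M[F]_(p, q2)) :
  CPair (row_mx A1 B1) (row_mx A0 B0) ~~~
  CPair (row_mx (A1 + B1 *m Z) B1) (row_mx (A0 + B0 *m Z) B0).
Proof.
have := pequiv_mul (row_mx A1 B1) (row_mx A0 B0)
  (two_sided_inverse1 F p) (two_sided_inverse_lower Z).
by rewrite -!mulmxA !mul_row_block !mx_simp.
Qed.

Lemma pequiv_block_rows p1 p2 q1 q2 (Z : 'M[F]_(p2, p1))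
    (A1 A0 : 'M[F]_(p1, q1)) (B1 B0 : 'M[F]_(p1, q2))
    (C1 C0 : 'M[F]_(p2, q1)) (D1 D0 : 'M[F]_(p2, q2)) :
  CPair (block_mx A1 B1 C1 D1) (block_mx A0 B0 C0 D0) ~~~
  CPair (block_mx A1 B1 (Z *m A1 + C1) (Z *m B1 + D1))
       (block_mx A0 B0 (Z *m A0 + C0) (Z *m B0 + D0)).
Proof.
rewrite !block_mxEv -!add_row_mx -!mul_mx_row.
exact: pequiv_add_rows.
Qed.

Lemma pequiv_block_columns p1 p2 q1 q2 (Z : 'M[F]_(q2, q1))
    (A1 A0 : 'M[F]_(p1, q1)) (B1 B0 : 'M[F]_(p1, q2))
    (C1 C0 : 'M[F]_(p2, q1)) (D1 D0 : 'M[F]_(p2, q2)) :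
  CPair (block_mx A1 B1 C1 D1) (block_mx A0 B0 C0 D0) ~~~
  CPair (block_mx (A1 + B1 *m Z) B1 (C1 + D1 *m Z) D1)
       (block_mx (A0 + B0 *m Z) B0 (C0 + D0 *m Z) D0).
Proof.
rewrite !block_mxEh -!add_col_mx -!mul_col_mx.
exact: pequiv_add_columns.
Qed.

(** The rows of lead E and of e, where e selects the last column of every L block,
    form a square invertible matrix, so K = Z lead E + G e.  The part Z is removed by row
    operations, whose constant residue is absorbed by the columns of -I, and G is
    invertible because (lead E; K) is, so it is normalized away.  What is left
    extends each L block by one row and one column. *)
Lemma append_rows_normal_form r s h (X1 X0 : 'M[F]_r)
    (K : 'M[F]_(h, r + sumn (map succn s)))
    (E := dsum (CPair X1 X0) (L_sum s)) KE :
  two_sided_inverse (col_mx (lead E) K) KE ->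
  CPair (block_mx (lead E) 0 K 0) (block_mx (tail E) 0 0 (- 1%:M : 'M_h)) ~~~
  dsum (CPair X1 X0) (L_sum (map succn s)).
Proof.
rewrite -[KE]hsubmxK; set Es := lsubmx KE; set Ks := rsubmx KE.
case; rewrite mul_col_row [1%:M]scalar_mx_block => /eq_block_mx[eEE eEK eKE eKK] eid.
rewrite mul_row_col in eid.
have uX : X1 \in unitmx.
  move: eEE; rewrite /E /= -[Es]submxK mulmx_block !mx_simp [1%:M]scalar_mx_block.
  by case/eq_block_mx => /mulmx1_unit[].
(* e is introduced through an equation to keep block rewriting from unfolding it. *)
have [e ee] : exists e : 'M[F]_(_, r + sumn (map succn s)),
  e = row_mx 0 (last_rows s) by eexists.
pose Ep := block_mx (invmx X1) 0 0 (lead (@L_sum F s))^T.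
pose ep := e^T.
have EEp : lead E *m Ep = 1%:M.
  by rewrite /E /Ep mulmx_block !mx_simp mulmxV // L_sum_leadK -scalar_mx_block.
have eep : e *m ep = 1%:M.
  by rewrite /ep ee tr_row_mx mul_row_col trmx0 !mx_simp last_rowsK.
have Eep : lead E *m ep = 0.
  by rewrite /ep ee tr_row_mx mul_block_col trmx0 !mx_simp L_sum_lead_last col_mx0.
have split1 : Ep *m lead E + ep *m e = 1%:M.
  rewrite /E /Ep mulmx_block !mx_simp mulVmx // /ep ee tr_row_mx trmx0 mul_col_row !mx_simp.
  by rewrite add_block_mx !mx_simp L_sum_lead_split -scalar_mx_block.
pose Z := K *m Ep; pose G := K *m ep; pose H := e *m Ks.
have KZG : K = Z *m lead E + G *m e.
  by rewrite /Z /G -!mulmxA -mulmxDr split1 mulmx1.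
have GH : two_sided_inverse G H.
  split.
    have : (K - Z *m lead E) *m Ks = 1%:M by rewrite mulmxBl -mulmxA eEK mulmx0 subr0.
    by rewrite {1}KZG addrC addKr -mulmxA.
  have eKs : Ks *m K = 1%:M - Es *m lead E by rewrite -eid addrAC subrr add0r.
  rewrite /H /G mulmxA -(mulmxA e) eKs mulmxBr mulmxBl mulmx1 eep.
  by rewrite -!mulmxA Eep !mulmx0 subr0.
have HG := two_sided_inverse_sym GH.
rewrite KZG.
(* Remove Z, then the constant residue, then rescale by H = G^-1. *)
apply: pequiv_trans (pequiv_block_rows (- Z) _ _ _ _ _ _ _ _) _.
rewrite !mx_simp mulNmx addKr.
apply: pequiv_trans (pequiv_block_columns (- Z *m tail E) _ _ _ _ _ _ _ _) _.
rewrite !mx_simp mulNmx mulmxN mulNmx mul1mx opprK addNr.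
have h3 := pequiv_mul (block_mx (lead E) 0 (G *m e) 0) (block_mx (tail E) 0 0 (- 1%:M))
  (two_sided_inverse_diag (two_sided_inverse1 F _) HG)
  (two_sided_inverse_diag (two_sided_inverse1 F _) GH).
apply: pequiv_trans h3 _.
rewrite !mulmx_block !mx_simp !mulmxN !mulNmx !mx_simp (mulmxA H) HG.1 mul1mx ee.
apply: pequiv_trans _ (pequiv_dsum (pequiv_refl _) (pequiv_L_extension _ s)).
have := pequiv_blockA X1 X0 0 0 0 0 0 0 (lead (L_sum s)) (tail (L_sum s))
  0 0 0 0 (last_rows s) 0 0 (- 1%:M).
rewrite /block3_mx !row_mx0 !col_mx0 => h4.
exact: pequiv_sym h4.
Qed.

Lemma row_injective_sub p1 p2 q1 q2 (A1 A0 : 'M[F]_(p1, q1))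
    (C1 C0 : 'M[F]_(p2, q1)) (D1 D0 : 'M[F]_(p2, q2)) :
  row_injective (CPair (block_mx A1 0 C1 D1) (block_mx A0 0 C0 D0)) ->
  row_injective (CPair A1 A0).
Proof.
move=> inj v ev; have/eqP : row_mx v (0 : 'rV_p2) = 0.
  apply: inj.
  by rewrite /= pencil_block mul_row_block ev !mul0mx pencil00 mulmx0 !addr0 row_mx0.
by rewrite row_mx_eq0 => /andP[/eqP].
Qed.

Lemma pequiv_rowA p q1 q2 q3 (A1 A0 : 'M[F]_(p, q1)) (B1 B0 : 'M[F]_(p, q2))
    (C1 C0 : 'M[F]_(p, q3)) :
  CPair (row_mx A1 (row_mx B1 C1)) (row_mx A0 (row_mx B0 C0)) ~~~
  CPair (row_mx (row_mx A1 B1) C1) (row_mx (row_mx A0 B0) C0).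
Proof. by rewrite 2!row_mxA; apply/pequiv_sym/pequiv_cast. Qed.

(** A Kronecker decomposition without left minimal indices, except that the square
    part is not reduced further.  The two cases below treat a leading coefficient
    with and without full row rank; each passes to a pencil with fewer columns. *)
Lemma kronecker_splitting (P : cpair F) : row_injective P ->
  exists r (X1 X0 : 'M[F]_r) s, P ~~~ dsum (CPair X1 X0) (L_sum s).
Proof.
have [w] := ubnP (width P); elim: w P => // w IHw [p q P1 P0].
rewrite [width _]/= ltnS => le_qw injP.
have [fP|nfP] := boolP (row_free P1).
  (* P ~ lambda [I 0] - [A B]; the square case stops the induction. *)
  have [q' [T [T' [iT eT]]]] := row_free_normal_form fP.
  have eq := two_sided_inverse_size iT.
  have := pequiv_mul P1 P0 (two_sided_inverse1 F p) iT; rewrite !mul1mx eT.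
  rewrite -[P0 *m T]hsubmxK; move: (lsubmx _) (rsubmx _) => A B eP.
  case: (posnP q') => [q0|q'_gt0].
    subst q'; exists p, 1%:M, A, [::].
    apply: pequiv_trans eP _; rewrite (thinmx0 B).
    exact: pequiv_zero_columns.
  (* B becomes [0 0; -I 0].  The h columns of -I clear the last h rows of A, the b
     zero columns are blocks L_0, and the first p' rows are the smaller pencil. *)
  have [p' [h [b [S [S' [T2 [T2' [iS iT2 eB]]]]]]]] := rank_normal_form B.
  have eqp := two_sided_inverse_size iS.
  have := pequiv_mul (row_mx 1%:M 0) (row_mx A B) iS
    (two_sided_inverse_diag (two_sided_inverse_sym iS) iT2).
  rewrite !mul_mx_row !mul_row_block !mx_simp iS.1 eB => /(pequiv_trans eP) {}eP.
  move: eP; set A' := S *m A *m S'; rewrite -[A']submxK block_mxEv.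
  move: (ulsubmx A') (ursubmx A') (dlsubmx A') (drsubmx A') => A11 A12 A21 A22 eP.
  have {}eP : CPair P1 P0 ~~~
      dsum (CPair (block_mx (row_mx 1%:M 0) 0 (row_mx 0 1%:M) (0 : 'M_(h, h)))
                  (block_mx (row_mx A11 A12) 0 0 (- 1%:M : 'M_h)))
           (CPair (0 : 'M_(0, b)) 0).
    apply: pequiv_trans _ (pequiv_zero_columns _ _ _).
    apply: pequiv_trans eP _.
    have := pequiv_add_columns (col_mx (row_mx A21 A22) 0) 1%:M
      (col_mx (row_mx A11 A12) (row_mx A21 A22)) 0
      (block_mx 0 0 (- 1%:M : 'M_h) (0 : 'M_(h, b))).
    move/pequiv_trans; apply.
    rewrite mul_block_col !mx_simp add_col_mx mulNmx mul1mx subrr addr0.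
    rewrite [block_mx 0 0 _ _]block_mxEh col_mx0 -(row_mx0 _ (p' + h) h b).
    apply: pequiv_trans (pequiv_rowA _ _ _ _ _ _) _.
    rewrite !block_mxEh col_mx0 -!block_mxEv -scalar_mx_block.
    exact: pequiv_refl.
  have injM := pequiv_row_injective eP injP.
  have /row_injective_sub injQ := row_injective_sub injM.
  have [] := IHw _ _ injQ.
    by apply: leq_trans _ le_qw; rewrite /= eqp eq -addn1 leq_add2l.
  move=> r [X1 [X0 [s [S3 [S3' [T3 [T3' [iS3 iT3 eL eT3]]]]]]]].
  exists r, X1, X0, (nseq b 0%N ++ map succn s).
  apply: pequiv_trans eP _.
  apply: pequiv_trans _ (pequiv_dsum (pequiv_refl _) (pequiv_L_zeros F b _)).
  apply: pequiv_trans _ (pequiv_dsum (pequiv_refl _) (dsumC _ _)).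
  apply: pequiv_trans _ (pequiv_sym (dsumA _ _ _)).
  apply: pequiv_dsum (pequiv_refl _).
  have := pequiv_mul (block_mx (row_mx 1%:M 0) 0 (row_mx 0 1%:M) (0 : 'M_(h, h)))
    (block_mx (row_mx A11 A12) 0 0 (- 1%:M : 'M_h))
    (two_sided_inverse_diag iS3 (two_sided_inverse1 F h))
    (two_sided_inverse_diag iT3 (two_sided_inverse1 F h)).
  rewrite !mulmx_block !mx_simp; move: (eL) eT3.
  rewrite [lead (CPair _ _)]/= [tail (CPair _ _)]/= => -> ->.
  move/pequiv_trans; apply.
  have iK := two_sided_inverseM (two_sided_inverse_diag iS3 (two_sided_inverse1 F h)) iT3.
  apply: (append_rows_normal_form _ (KE := T3' *m block_mx S3' 0 0 1%:M)).
  rewrite -eL; suff -> : col_mx (S3 *m row_mx 1%:M 0 *m T3) (row_mx 0 1%:M *m T3) =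
    block_mx S3 0 0 1%:M *m T3 by [].
  by rewrite -mul_col_mx mul_mx_row !mx_simp -block_mxEv.
(* The rows of U kill P1, so U P is a constant matrix of full row rank; normalized
   to -[I 0] it joins the square part, and the remaining rows and columns form the
   smaller pencil (Q1, Q0). *)
pose U := row_base (kermx P1).
have U0 : U *m P1 = 0 by apply/sub_kermxP; rewrite eq_row_base.
have fU : row_free U by apply: row_base_free.
have hgt0 : (0 < \rank (kermx P1))%N by rewrite lt0n mxrank_eq0 kermx_eq0.
move: (\rank (kermx P1)) hgt0 U U0 fU => h hgt0 U U0 fU.
have [h' [U2 [S iS]]] := row_free_completion fU.
have fH : row_free (U *m P0).
  apply: inj_row_free => u; rewrite mulmxA => euP.
  have : cst_mx (u *m U) = 0.
    by apply: injP; rewrite pencil_mull -!mulmxA U0 mulmxA euP mulmx0 pencil00.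
  by rewrite -(cst_mx0 F) => /cst_mx_inj/eqP; rewrite mulmx_free_eq0 // => /eqP.
have [q' [T [T' [iT eT]]]] := row_free_normal_form fH.
have eq := two_sided_inverse_size iT.
have := pequiv_mul P1 P0 iS iT.
rewrite !mul_col_mx U0 mul0mx eT -[U2 *m P1 *m T]hsubmxK -[U2 *m P0 *m T]hsubmxK.
move: (lsubmx (U2 *m P1 *m T)) (rsubmx (U2 *m P1 *m T)) => y1 Q1.
move: (lsubmx (U2 *m P0 *m T)) (rsubmx (U2 *m P0 *m T)) => y0 Q0 eP.
have := pequiv_trans eP (pequiv_add_rows (- y0) _ _ _ _).
rewrite !mx_simp mul_mx_row add_row_mx !mx_simp addNr -(row_mx0 _ h h q') -!block_mxEv => {}eP.
have injQ : row_injective (CPair Q1 Q0).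
  move=> v ev; have /eqP : row_mx (v *m pencil y1 0) v = 0.
    apply: (pequiv_row_injective eP injP).
    rewrite /= pencil_block mul_row_block ev !pencil00 mulmx0 add0r.
    by rewrite pencil01 mulmxN mulmx1 addNr row_mx0.
  by rewrite row_mx_eq0 => /andP[_ /eqP].
have [] := IHw _ _ injQ.
  by apply: leq_trans _ le_qw; rewrite /= eq -addn1 addnC leq_add2r.
move=> r [X1 [X0 [s [S3 [S3' [T3 [T3' [iS3 iT3 eL eT3]]]]]]]].
have := pequiv_mul (block_mx 0 0 y1 Q1) (block_mx 1%:M 0 0 Q0)
  (two_sided_inverse_diag (two_sided_inverse1 F h) iS3)
  (two_sided_inverse_diag (two_sided_inverse1 F h) iT3).
move/(pequiv_trans eP); rewrite !mulmx_block !mx_simp.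
move: eL eT3; rewrite [lead (CPair _ _)]/= [tail (CPair _ _)]/= => -> -> {}eP.
move: eP; rewrite -[S3 *m y1]vsubmxK.
move: (usubmx (S3 *m y1)) (dsubmx (S3 *m y1)) => yx yl eP.
(* The part yl of the coupling columns that faces the L blocks is cleared by their
   columns, since their leading coefficient has a right inverse; this spoils only
   constant coefficients, which the row of -I clears. *)
pose t := (lead (@L_sum F s))^T *m yl.
have := pequiv_trans eP (pequiv_block_columns (col_mx 0 (- t)) _ _ _ _ _ _ _ _).
rewrite !mx_simp !mul_block_col !add_col_mx !mx_simp !mulmxN mulmxA L_sum_leadK mul1mx subrr.
set w0 := col_mx 0 (- _) => {}eP.
have := pequiv_trans eP (pequiv_block_rows (- w0) _ _ _ _ _ _ _ _).
rewrite !mx_simp addNr => {}eP.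
exists (h + r)%N, (block_mx 0 0 yx X1), (block_mx 1%:M 0 0 X0), s.
apply: pequiv_trans eP _.
have := pequiv_blockA (0 : 'M_h) (1%:M : 'M[F]_h) 0 0 0 0 yx 0 X1 X0 0 0 0 0 0 0
  (lead (L_sum s)) (tail (L_sum s)).
by rewrite /block3_mx !row_mx0 !col_mx0.
Qed.

End KroneckerReduction.

(** * Splitting off a Jordan block *)

Section JordanBlocks.
Variable F : fieldType.

(** The row space of K is invariant, and so is its complement, the left kernel of L;
    the projection onto the latter along the former is e = 1 - L (K L)^-1 K. *)
Lemma split_invariant_block n k (M : 'M[F]_n) (J : 'M[F]_k)
    (K : 'M[F]_(k, n)) (L : 'M[F]_(n, k)) :
  K *m M = J *m K -> M *m L = L *m J -> K *m L \in unitmx ->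
  exists n' (M' : 'M[F]_n') S S',
    two_sided_inverse S S' /\ S *m M *m S' = block_mx J 0 0 M'.
Proof.
move=> eK eL uH; pose H := invmx (K *m L).
have [n' [C [fC eC]]] : exists n' (C : 'M_(n', n)), row_free C /\ (C :=: kermx L)%MS.
  exists _, (row_base (kermx L)); split; first exact: row_base_free.
  exact: eq_row_base.
have CL : C *m L = 0 by apply/sub_kermxP; rewrite eC.
pose e := 1%:M - L *m H *m K.
have /submxP[D eD] : (e <= C)%MS.
  rewrite eC; apply/sub_kermxP.
  by rewrite mulmxBl mul1mx -!mulmxA mulVmx // mulmx1 subrr.
have CD : C *m D = 1%:M.
  apply: (row_free_inj fC); rewrite /= -mulmxA -eD /e mulmxBr mulmx1.
  by rewrite !mulmxA CL !mul0mx subr0 mul1mx.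
have KD : K *m D = 0.
  apply: (row_free_inj fC); rewrite /= -mulmxA -eD /e mulmxBr mulmx1 !mulmxA mulmxV //.
  by rewrite mul1mx subrr mul0mx.
pose S := col_mx K C; pose S' := row_mx (L *m H) D.
have SS : two_sided_inverse S S'.
  split.
    by rewrite mul_col_row !mulmxA mulmxV // KD CL mul0mx CD -scalar_mx_block.
  by rewrite mul_row_col -eD /e addrC subrK.
exists _, (C *m M *m D), S, S'; split=> //.
rewrite mul_col_mx eK mul_col_row -!(mulmxA J) KD !mulmx0.
rewrite (mulmxA K) mulmxV // mulmx1 (mulmxA _ L) -(mulmxA C) eL.
by rewrite (mulmxA C) CL !mul0mx.
Qed.

Lemma jordan_blockE a k : jordan_block a k = a%:M + jordan_block 0 k :> 'M[F]_k.
Proof.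
apply/matrixP=> i j; rewrite !mxE.
have -> : (i == j) = (j == i :> nat) by rewrite eq_sym.
case: eqP => _; last by rewrite mulr0n add0r.
by rewrite mulr1n addr0.
Qed.

Lemma expr_jordan_block0 k j :
  jordan_block (0 : F) k ^+ j = \matrix_(i, l) (l == (i + j)%N :> nat)%:R.
Proof.
elim: j => [|j IH].
  by apply/matrixP=> i l; rewrite expr0 !mxE addn0 eq_sym.
apply/matrixP=> i l; rewrite exprSr IH -mulmxE !mxE.
under eq_bigr do rewrite !mxE.
rewrite (sum_eq_nat _ (fun h => if l == h :> nat then 0 else if l == h.+1 :> nat then 1 else 0)).
rewrite addnS; case: (l =P (i + j).+1 :> nat) => [e|_].
  by rewrite e gtn_eqF // mulr1 -e ltnW // -e ltn_ord.
by case: eqP; rewrite mulr0.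
Qed.

Lemma upper_trig_unit k (M : 'M[F]_k) a : a != 0 ->
  (forall i, M i i = a) -> (forall i j : 'I_k, (j < i)%N -> M i j = 0) -> M \in unitmx.
Proof.
move=> a0 eM tM; rewrite unitmxE -det_tr det_trig; last first.
  by apply/is_trig_mxP=> i j lt; rewrite mxE tM.
by rewrite unitfE; apply/prodf_neq0 => i _; rewrite mxE eM.
Qed.

(** The rows v N^i and the columns N^(k - j) f span invariant spaces on which N acts
    by a nilpotent Jordan block.  Their pairing v N^(i + k - j) f is upper triangular
    with the nonzero number v N^k f on the diagonal, so split_invariant_block
    applies. *)
Lemma jordan_chain_split n k (M : 'M[F]_n) c (v : 'rV_n) (f : 'cV_n)
    (N := M - c%:M) :
  v *m N ^+ k.+1 = 0 -> N ^+ k.+1 *m f = 0 -> v *m N ^+ k *m f != 0 ->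
  exists n' (M' : 'M[F]_n') S S',
    two_sided_inverse S S' /\ S *m M *m S' = block_mx (jordan_block c k.+1) 0 0 M'.
Proof.
move=> vN Nf vNf.
pose K := \matrix_(i < k.+1) (v *m N ^+ i).
pose L := (\matrix_(j < k.+1) (N ^+ (k - j) *m f)^T)^T.
have eM : M = c%:M + N by rewrite addrC subrK.
apply: (@split_invariant_block _ _ _ _ K L).
- rewrite jordan_blockE eM mulmxDr mulmxDl scalar_mxC; congr (_ + _).
  apply/row_matrixP=> i; rewrite !row_mul rowK -mulmxA mulmxE -exprSr [RHS]mulmx_sum_row.
  case: (ltnP i.+1 k.+1) => [lt|le].
    rewrite (bigD1 (Ordinal lt)) //= rowK !mxE /= eqxx gtn_eqF // scale1r big1 ?addr0 //.
    move=> l ne; rewrite !mxE; case: eqP => _; first by rewrite scale0r.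
    by rewrite -val_eqE /= in ne; rewrite (negbTE ne) scale0r.
  have -> : i.+1 = k.+1 by apply/eqP; rewrite eqn_leq le (ltn_ord i).
  rewrite vN big1 // => l _; rewrite !mxE.
  by rewrite [l == i.+1 :> nat]ltn_eqF ?if_same ?scale0r // (leq_trans (ltn_ord l) le).
- rewrite jordan_blockE eM mulmxDr mulmxDl scalar_mxC; congr (_ + _).
  apply: trmx_inj; rewrite !trmx_mul /L trmxK.
  apply/row_matrixP=> j; rewrite !row_mul rowK -trmx_mul mulmxA mulmxE -exprS [RHS]mulmx_sum_row.
  case: j => [[|j] lt] /=.
    rewrite subn0 Nf trmx0 big1 // => l _; rewrite !mxE /=.
    by rewrite if_same scale0r.
  rewrite (bigD1 (Ordinal (ltnW lt))) //= rowK !mxE /= gtn_eqF // eqxx scale1r.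
  rewrite -subSn // subSS big1 ?addr0 // => l ne; rewrite !mxE /= eqSS [j == l]eq_sym.
  by rewrite -val_eqE /= in ne; rewrite (negbTE ne) if_same scale0r.
have KL i j : (K *m L) i j = (v *m N ^+ (i + (k - j))%N *m f) 0 0.
  rewrite exprD -mulmxE mulmxA -(mulmxA (v *m _)) [in RHS]mxE mxE.
  by apply: eq_bigr => l _; rewrite !mxE; congr (_ * _); rewrite mxE.
apply: (@upper_trig_unit _ _ ((v *m N ^+ k *m f) 0 0)).
- by apply: contra vNf => /eqP e; apply/eqP/matrixP=> i j; rewrite !ord1 e mxE.
- by move=> i; rewrite KL subnKC // -ltnS.
move=> i j lt; rewrite KL.
have -> : (i + (k - j) = k.+1 + (i - j.+1))%N.
  by rewrite -{1}(subnKC lt) addnAC addSn subnKC // -ltnS.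
by rewrite exprD -mulmxE mulmxA vN !mul0mx mxE.
Qed.

Lemma matrix_neq0P p q (A : 'M[F]_(p, q)) : A != 0 -> exists i j, A i j != 0.
Proof.
move=> A0; have [/existsP[i /existsP[j Aij]]|] := boolP [exists i, exists j, A i j != 0].
  by exists i, j.
rewrite negb_exists => /forallP no; case/eqP: A0; apply/matrixP=> i j.
move: (no i); rewrite negb_exists => /forallP/(_ j).
by rewrite negbK mxE => /eqP.
Qed.

(** With k + 1 the least exponent from which the ranks of the powers of N are
    constant, the left and right kernels of N^(k+1) are paired nontrivially by N^k:
    otherwise the left kernel times N^k would lie in the row space of N^(k+1), on
    which N is injective, and hence vanish, against the choice of k. *)
Lemma nilpotent_jordan_chain n (N : 'M[F]_n) : N \notin unitmx ->
  exists k (v : 'rV_n) (f : 'cV_n),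
    [/\ v *m N ^+ k.+1 = 0, N ^+ k.+1 *m f = 0 & v *m N ^+ k *m f != 0].
Proof.
move=> sN.
have le j : (\rank (N ^+ j.+1) <= \rank (N ^+ j))%N.
  by rewrite exprS -mulmxE; apply: mxrankM_maxr.
have exh : exists h, \rank (N ^+ h.+1) == \rank (N ^+ h).
  have stable b : forall j, (\rank (N ^+ j) <= b)%N ->
      exists h, \rank (N ^+ h.+1) == \rank (N ^+ h).
    elim: b => [|b IH] j le_b; have := le j; rewrite leq_eqVlt => /orP[eqj|ltj].
    - by exists j.
    - by move: (leq_trans ltj le_b); rewrite ltn0.
    - by exists j.
    - by apply: (IH j.+1); rewrite -ltnS (leq_trans ltj).
  exact: stable (leqnn (\rank (N ^+ 0))).
case: (ex_minnP exh) => -[|k] /eqP eqk mink.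
  case/negP: sN; rewrite -row_free_unit /row_free.
  by move: eqk; rewrite expr1 expr0 mxrank1 => ->.
have ltk : (\rank (N ^+ k.+1) < \rank (N ^+ k))%N.
  rewrite ltn_neqAle le andbT; apply/negP=> /mink; by rewrite ltnn.
pose K := kermx (N ^+ k.+1); pose C := cokermx (N ^+ k.+1).
have KN : K *m N ^+ k.+1 = 0 by apply: mulmx_ker.
have NC : N ^+ k.+1 *m C = 0 by apply: mulmx_coker.
have : K *m N ^+ k *m C != 0.
  rewrite -submxE; apply/negP=> /submxP[D eD].
  have cap0 : (N ^+ k.+1 :&: kermx N)%MS = 0.
    apply/eqP; rewrite -mxrank_eq0 -(eqn_add2l (\rank (N ^+ k.+1 *m N))).
    by rewrite mxrank_mul_ker addn0 mulmxE -exprSr eqk.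
  have D0 : D *m N ^+ k.+1 = 0.
    apply/eqP; rewrite -submx0 -cap0 sub_capmx submxMl /=; apply/sub_kermxP.
    by rewrite -eD -mulmxA mulmxE -exprSr.
  have : (K <= kermx (N ^+ k))%MS by apply/sub_kermxP; rewrite eD.
  move/mxrankS; rewrite !mxrank_ker leqNgt ltn_sub2l //.
  exact: leq_trans ltk (rank_leq_row _).
move: K C KN NC => K C KN NC; case/matrix_neq0P=> i [j ij].
exists k, (delta_mx 0 i *m K), (C *m delta_mx j 0).
split; first by rewrite -mulmxA KN mulmx0.
  by rewrite mulmxA NC mul0mx.
apply: contra ij => /eqP; rewrite !mulmxA -(mulmxA _ K) -(mulmxA _ (K *m _)).
by rewrite -rowE -colE => /matrixP/(_ 0 0); rewrite !mxE => ->.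
Qed.

End JordanBlocks.

(** * Weierstrass form of regular pencils *)

Section Weierstrass.
Variable F : closedFieldType.

Lemma eigenvalue_exists n (M : 'M[F]_n) : (0 < n)%N ->
  exists c, M - c%:M \notin unitmx.
Proof.
move=> n0; have /closed_rootP[c rc] : size (char_poly M) != 1%N.
  by rewrite size_char_poly; case: (n) n0.
exists c; move: rc; rewrite -eigenvalue_root_char /eigenvalue /eigenspace.
by rewrite kermx_eq0 row_free_unit.
Qed.

(** A root of p - 1 will do, unless p - 1 is a nonzero constant, and then p is itself
    a constant. *)
Lemma poly_non_root (p : {poly F}) : p != 0 -> exists a, p.[a] != 0.
Proof.
move=> p0; case: (boolP (size (p - 1) == 1%N)) => [|/closed_rootP[a]].
  case/size_poly1P => b b0 e; exists 0.
  move: p0; have -> : p = (b + 1)%:P by rewrite polyCD -e subrK.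
  by rewrite hornerC polyC_eq0.
by rewrite /root hornerD hornerN hornerC subr_eq0 => /eqP e; exists a; rewrite e oner_eq0.
Qed.

Lemma jordan_block_split n (M : 'M[F]_n) : (0 < n)%N ->
  exists c k n' (M' : 'M[F]_n') S S',
    two_sided_inverse S S' /\ S *m M *m S' = block_mx (jordan_block c k.+1) 0 0 M'.
Proof.
case/(eigenvalue_exists M)=> c /nilpotent_jordan_chain[k [v [f [vN Nf vNf]]]].
by exists c, k; apply: jordan_chain_split vN Nf vNf.
Qed.

Lemma invmx_comm k (A B : 'M[F]_k) :
  A \in unitmx -> A *m B = B *m A -> invmx A *m B = B *m invmx A.
Proof.
move=> uA AB; apply: (can_inj (mulKmx uA)).
by rewrite mulKVmx // mulmxA AB mulmxK.
Qed.

(** A unit W commuting with the nilpotent block J leaves its nilpotency index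
    unchanged, so the Jordan block split off from c + W J already has full size.  It
    identifies the rational functions of a Jordan block met below. *)
Lemma similar_jordan_block k c (W : 'M[F]_k.+1) :
  W \in unitmx -> W *m jordan_block 0 k.+1 = jordan_block 0 k.+1 *m W ->
  exists S S', two_sided_inverse S S' /\
    S *m (c%:M + W *m jordan_block 0 k.+1) *m S' = jordan_block c k.+1.
Proof.
set J := jordan_block 0 k.+1 => uW cWJ; set N := c%:M + W *m J.
have eN : N - c%:M = W *m J by rewrite addrC addKr.
have pow j : (W *m J) ^+ j = W ^+ j *m J ^+ j by rewrite !mulmxE exprMn_comm.
have Jk : J ^+ k.+1 = 0.
  apply/matrixP=> i j; rewrite expr_jordan_block0 !mxE ltn_eqF //.
  exact: leq_trans (ltn_ord j) (leq_addl _ _).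
have uWk : W ^+ k \in unitmx by apply: unitrX.
have [||| n' [M' [S [S' [iS eS]]]]] :=
  @jordan_chain_split F k.+1 k N c (delta_mx 0 0 *m invmx (W ^+ k)) (delta_mx ord_max 0).
- by rewrite eN pow Jk !mulmx0.
- by rewrite eN pow Jk !mulmx0 mul0mx.
- rewrite eN pow mulmxA mulmxKV // -mulmxA -rowE -colE.
  apply/eqP=> /matrixP/(_ 0 0)/eqP.
  by rewrite expr_jordan_block0 !mxE add0n eqxx oner_eq0.
have n'0 : n' = 0%N.
  by apply/eqP; rewrite -(eqn_add2l k.+1) addn0 (two_sided_inverse_size iS).
subst n'; exists (usubmx S), (lsubmx S').
move: iS eS; rewrite -[S]vsubmxK -[S']hsubmxK => -[+ _].
rewrite mul_col_row scalar_mx_block => /eq_block_mx[e _ _ _].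
rewrite mul_col_mx mul_col_row => /eq_block_mx[eS _ _ _].
by rewrite !col_mxKu !row_mxKl; split=> //; split=> //; apply: mulmx1C.
Qed.

(** After splitting off a block J = J_k(c) of M, the summand lambda J - (mu J - I) is
    multiplied by (mu J - I)^-1 if c = 0, giving an infinite block, and by J^-1
    otherwise, giving the finite eigenvalue mu - 1/c. *)
Lemma shifted_pencil_form n (M : 'M[F]_n) mu : exists fs ifs,
  CPair M (mu *: M - 1%:M) ~~~
  dsum (CPair 1%:M (jordan_mx fs)) (CPair (nilpotent_jordan_mx F ifs) 1%:M).
Proof.
have [w] := ubnP n; elim: w n M => // w IHw n M; rewrite ltnS => le_nw.
case: (posnP n) => [n0|n_gt0].
  by subst n; exists [::], [::]; apply: pequiv_flat0.
have [c [k [n' [M' [S [S' [iS eS]]]]]]] := jordan_block_split M n_gt0.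
have [|fs [ifs eM']] := IHw n' M'.
  apply: leq_trans _ le_nw; rewrite -(two_sided_inverse_size iS).
  by rewrite addSn ltnS leq_addl.
set J := jordan_block c k.+1 in eS.
have eM : CPair M (mu *: M - 1%:M) ~~~
    dsum (CPair J (mu *: J - 1%:M)) (CPair M' (mu *: M' - 1%:M)).
  have := pequiv_mul M (mu *: M - 1%:M) iS (two_sided_inverse_sym iS).
  rewrite mulmxBr mulmxBl -scalemxAr -scalemxAl eS mulmx1 iS.1.
  by rewrite scalar_mx_block scale_block_mx opp_block_mx add_block_mx !scaler0 !subr0.
have {}eM := pequiv_trans eM (pequiv_dsum (pequiv_refl _) eM').
have eJ : J = c%:M + jordan_block 0 k.+1 := jordan_blockE c k.+1.
have [c0|c0] := eqVneq c 0.
  exists fs, (k.+1 :: ifs); apply: pequiv_trans eM _.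
  apply: pequiv_trans (dsumCA _ _ _) _; apply: pequiv_dsum (pequiv_refl _) _.
  have -> : CPair (nilpotent_jordan_mx F (k.+1 :: ifs)) 1%:M =
    dsum (CPair (jordan_block (0 : F) k.+1) 1%:M) (CPair (nilpotent_jordan_mx F ifs) 1%:M).
    by rewrite /dsum /= -scalar_mx_block.
  apply: pequiv_dsum _ (pequiv_refl _).
  rewrite eJ c0 raddf0 add0r; set J0 := jordan_block 0 k.+1.
  have u : mu *: J0 - 1%:M \in unitmx.
    apply: (@upper_trig_unit _ _ _ (-1)); first by rewrite oppr_eq0 oner_eq0.
      by move=> i; rewrite !mxE !eqxx mulr0 sub0r.
    move=> i j lt; rewrite !mxE (ltn_eqF lt) (@ltn_eqF j i.+1) ?ltnS ?(ltnW lt) // mulr0 sub0r.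
    by rewrite -val_eqE /= gtn_eqF // oppr0.
  have [||S3 [S3' [iS3 eS3]]] := @similar_jordan_block k 0 (invmx (mu *: J0 - 1%:M)).
  - by rewrite unitmx_inv.
  - apply: invmx_comm u _.
    by rewrite mulmxBl mulmxBr mul1mx mulmx1 -scalemxAl -scalemxAr.
  have := pequiv_mul J0 (mu *: J0 - 1%:M)
    (two_sided_inverseM iS3 (two_sided_inverse_sym (two_sided_inverse_unit u)))
    (two_sided_inverse_sym iS3).
  rewrite -!(mulmxA S3) mulVmx // mul1mx iS3.1.
  by move: eS3; rewrite raddf0 add0r -!mulmxA => ->.
exists ((mu - c^-1, k.+1) :: fs), ifs; apply: pequiv_trans eM _.
apply: pequiv_trans (dsumA _ _ _) _; apply: pequiv_dsum _ (pequiv_refl _).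
have -> : CPair 1%:M (jordan_mx ((mu - c^-1, k.+1) :: fs)) =
  dsum (CPair 1%:M (jordan_block (mu - c^-1) k.+1)) (CPair 1%:M (jordan_mx fs)).
  by rewrite /dsum /= -scalar_mx_block.
apply: pequiv_dsum _ (pequiv_refl _).
have u : J \in unitmx.
  apply: (@upper_trig_unit _ _ _ c) => // [i|i j lt]; first by rewrite mxE eqxx.
  by rewrite mxE (ltn_eqF lt) (@ltn_eqF j i.+1) // ltnS ltnW.
set J0 := jordan_block 0 k.+1 in eJ.
have [||S3 [S3' [iS3 eS3]]] := @similar_jordan_block k (mu - c^-1) (c^-1 *: invmx J).
- by rewrite unitmxZ ?unitmx_inv // unitfE invr_eq0.
- rewrite -scalemxAl -scalemxAr invmx_comm // eJ mulmxDl mulmxDr.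
  by rewrite scalar_mxC.
have eN : (mu - c^-1)%:M + c^-1 *: invmx J *m jordan_block 0 k.+1 =
    invmx J *m (mu *: J - 1%:M).
  have -> : jordan_block 0 k.+1 = J - c%:M by rewrite eJ addrC addKr.
  rewrite !mulmxBr -!scalemxAr -!scalemxAl !mulVmx // mulmx1 mul_mx_scalar scalerA mulVf //.
  by rewrite scale1r -scalemx1 scalerBl addrA subrK.
have := pequiv_mul J (mu *: J - 1%:M)
  (two_sided_inverseM iS3 (two_sided_inverse_sym (two_sided_inverse_unit u)))
  (two_sided_inverse_sym iS3).
rewrite -!(mulmxA S3) mulVmx // mul1mx iS3.1.
by move: eS3; rewrite eN -!mulmxA => ->.
Qed.

(** Dividing by the invertible value mu X1 - X0 normalizes that value to the identity
    and leaves a pencil that depends on one matrix only. *)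
Lemma weierstrass_form n (X1 X0 : 'M[F]_n) : \det (pencil X1 X0) != 0 ->
  exists fs ifs, CPair X1 X0 ~~~
  dsum (CPair 1%:M (jordan_mx fs)) (CPair (nilpotent_jordan_mx F ifs) 1%:M).
Proof.
case/poly_non_root=> mu; rewrite -horner_evalE -det_map_mx.
set Y := map_mx _ _; have -> : Y = mu *: X1 - X0.
  by apply/matrixP=> i j; rewrite !mxE /= horner_evalE !hornerE.
move=> d0; have u : mu *: X1 - X0 \in unitmx by rewrite unitmxE unitfE.
have [fs [ifs e]] := shifted_pencil_form (invmx (mu *: X1 - X0) *m X1) mu.
exists fs, ifs; apply: pequiv_trans _ e.
have := pequiv_mul X1 X0 (two_sided_inverse_sym (two_sided_inverse_unit u))
  (two_sided_inverse1 F n).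
rewrite !mulmx1; suff -> : invmx (mu *: X1 - X0) *m X0 =
  mu *: (invmx (mu *: X1 - X0) *m X1) - 1%:M by [].
by rewrite -(mulVmx u) mulmxBr -scalemxAr subKr.
Qed.

End Weierstrass.

(** * Kronecker data of the pencils at hand *)

Section RegularPencils.
Variable F : fieldType.

Lemma det_neq0P n (M : 'M[{poly F}]_n) :
  (forall v : 'rV_n, v *m M = 0 -> v = 0) -> \det M != 0.
Proof.
by move=> inj; apply/det0P=> -[v v0 vM]; case/eqP: v0; apply: inj.
Qed.

Lemma det_neq0_mul0mx n k (M : 'M[{poly F}]_n) (v : 'M_(k, n)) :
  \det M != 0 -> v *m M = 0 -> v = 0.
Proof.
move=> d0 /(congr1 (fun z => z *m \adj M)).
rewrite -mulmxA mul_mx_adj mul0mx mul_mx_scalar => /matrixP e.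
apply/matrixP=> i j; move/eqP: (e i j); rewrite !mxE mulf_eq0 (negbTE d0) /=.
by move/eqP.
Qed.

Lemma det_neq0_mulmx0 n k (M : 'M[{poly F}]_n) (v : 'M_(n, k)) :
  \det M != 0 -> M *m v = 0 -> v = 0.
Proof.
rewrite -det_tr => d0 /(congr1 trmx); rewrite trmx_mul trmx0.
by move/(det_neq0_mul0mx d0)/(congr1 trmx); rewrite trmxK trmx0.
Qed.

Lemma pequiv_tr p q p' q' (M1 M0 : 'M[F]_(p, q)) (N1 N0 : 'M[F]_(p', q')) :
  CPair M1 M0 ~~~ CPair N1 N0 -> CPair M1^T M0^T ~~~ CPair N1^T N0^T.
Proof.
move=> [S [S' [T [T' [[S1 S2] [T1 T2] /= <- <-]]]]].
exists T^T, T'^T, S^T, S'^T; split; rewrite /= ?trmx_mul ?mulmxA //.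
  by split; rewrite -trmx_mul ?T1 ?T2 trmx1.
by split; rewrite -trmx_mul ?S1 ?S2 trmx1.
Qed.

(** The bridge between the casts in the definition of strict equivalence and the
    rectangular transformations used here. *)
Lemma strictly_equivalentP p q p' q' (M1 M0 : 'M[F]_(p, q)) (N1 N0 : 'M[F]_(p', q')) :
  strictly_equivalent (pencil M1 M0) (pencil N1 N0) <-> CPair M1 M0 ~~~ CPair N1 N0.
Proof.
split.
  case=> ep [eq [S [T [uS uT]]]]; subst p' q'; rewrite castmx_id pencil_mul.
  case/pencil_inj=> e1 e0; exists S, (invmx S), T, (invmx T).
  by split=> //; apply: two_sided_inverse_unit.
case=> S [S' [T [T' /= [iS iT e1 e0]]]].
have ep := two_sided_inverse_size iS; have eq := esym (two_sided_inverse_size iT).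
subst p' q'; exists erefl, erefl, S, T; rewrite castmx_id pencil_mul e1 e0.
by split=> //; [apply: two_sided_inverse_unitP iS | apply: two_sided_inverse_unitP iT].
Qed.

Definition LT_sum s : cpair F :=
  CPair (diag_blocks (p := succn) (q := id) (fun k => (L_lead F k)^T) s)
       (diag_blocks (p := succn) (q := id) (fun k => (L_tail F k)^T) s).

Definition kcf_cpair (K : kronecker_data F) : cpair F :=
  dsum (LT_sum (left_indices K))
    (dsum (CPair 1%:M (kcf_AJ K)) (dsum (CPair (kcf_N K) 1%:M) (L_sum (right_indices K)))).

Lemma kcf_mxE K : kcf_mx K = pencil (lead (kcf_cpair K)) (tail (kcf_cpair K)).
Proof.
rewrite /kcf_mx /kcf_cpair /= !pencil_block !pencil00 -!diag_blocks_pencil.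
congr (block_mx _ 0 0 (block_mx _ 0 0 (block_mx _ 0 0 _))).
  by apply: eq_diag_blocks => k; rewrite -tr_pencil -L_pencilE.
by apply: eq_diag_blocks => k; rewrite -L_pencilE.
Qed.

Lemma has_kcfP p q (M1 M0 : 'M[F]_(p, q)) K :
  has_kcf (pencil M1 M0) K <-> CPair M1 M0 ~~~ kcf_cpair K.
Proof. by rewrite /has_kcf kcf_mxE; apply: strictly_equivalentP. Qed.

Lemma dsum_empty (M1 M0 : 'M[F]_(0, 0)) P : dsum (CPair M1 M0) P ~~~ P.
Proof.
apply: pequiv_trans _ (dsum0p P); apply: pequiv_dsum (pequiv_refl _).
exact: pequiv_flat0.
Qed.

Lemma L_sum_kcf s : kcf_cpair (KroneckerData [::] [::] [::] s) ~~~ L_sum s.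
Proof.
apply: pequiv_trans (dsum_empty _ _ _) _; apply: pequiv_trans (dsum_empty _ _ _) _.
exact: dsum_empty.
Qed.

Lemma L_sum_no_eigenvalues p q (M1 M0 : 'M[F]_(p, q)) s :
  CPair M1 M0 ~~~ L_sum s -> no_eigenvalues (pencil M1 M0).
Proof.
move=> e; exists (KroneckerData [::] [::] [::] s); split=> //.
exact/has_kcfP/(pequiv_trans e)/pequiv_sym/L_sum_kcf.
Qed.

Lemma regular_kcf fs ifs s :
  kcf_cpair (KroneckerData [::] fs ifs s) ~~~
  dsum (dsum (CPair 1%:M (jordan_mx fs)) (CPair (nilpotent_jordan_mx F ifs) 1%:M)) (L_sum s).
Proof. by apply: pequiv_trans (dsum_empty _ _ _) _; apply: dsumA. Qed.

End RegularPencils.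

Section ClosedField.
Variable F : closedFieldType.

Lemma jordan_eigenvalues (fs : seq (F * nat)) :
  exists z : seq F, char_poly (jordan_mx fs) = \prod_(x <- z) ('X - x%:P).
Proof.
have [z ez] := closed_field_poly_normal (char_poly (jordan_mx fs)).
exists z; rewrite ez; have /monicP -> := char_poly_monic (jordan_mx fs).
by rewrite scale1r.
Qed.

(** The eigenvalues of diag(X, L blocks) are those of X, because both have the same
    Jordan blocks in their canonical forms. *)
Lemma regular_plus_L_eigenvalues p q (P1 P0 : 'M[F]_(p, q)) r (X1 X0 : 'M[F]_r)
    r' (Y1 Y0 : 'M[F]_r') s :
  \det (pencil X1 X0) != 0 -> CPair Y1 Y0 ~~~ CPair X1 X0 ->
  CPair P1 P0 ~~~ dsum (CPair X1 X0) (L_sum s) ->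
  number_of_eigenvalues (pencil P1 P0) r /\
  same_eigenvalues (pencil P1 P0) (pencil Y1 Y0).
Proof.
move=> /weierstrass_form[fs [ifs eX]] eY eP.
have kP : has_kcf (pencil P1 P0) (KroneckerData [::] fs ifs s).
  apply/has_kcfP/(pequiv_trans eP).
  apply: pequiv_trans (pequiv_dsum eX (pequiv_refl _)) _.
  exact/pequiv_sym/regular_kcf.
have kY : has_kcf (pencil Y1 Y0) (KroneckerData [::] fs ifs [::]).
  apply/has_kcfP/(pequiv_trans eY)/(pequiv_trans eX).
  apply: pequiv_trans (pequiv_sym (dsump0 _)) _.
  exact/pequiv_sym/(regular_kcf fs ifs [::]).
split; first by exists (KroneckerData [::] fs ifs s); split; last case: (pequiv_size eX).
have [z ez] := jordan_eigenvalues fs.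
exists z, (kcf_rinf (KroneckerData [::] fs ifs s)).
split; first by exists (KroneckerData [::] fs ifs s).
by exists (KroneckerData [::] fs ifs [::]).
Qed.

(** The value at the point (a : b) of the projective line; (1 : 0) is the point at
    infinity, where the value is the leading coefficient. *)
Definition pencil_at p q (a b : F) (M1 M0 : 'M[F]_(p, q)) := a *: M1 - b *: M0.

Lemma pencil_at_mul p q p' q' (S : 'M[F]_(p', p)) (T : 'M[F]_(q, q')) a b
    (M1 M0 : 'M[F]_(p, q)) :
  pencil_at a b (S *m M1 *m T) (S *m M0 *m T) = S *m pencil_at a b M1 M0 *m T.
Proof. by rewrite /pencil_at mulmxBr mulmxBl -!scalemxAr -!scalemxAl. Qed.

Lemma pencil_at_block p1 p2 q1 q2 a b (A1 A0 : 'M[F]_(p1, q1)) (B1 B0 : 'M[F]_(p1, q2))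
    (C1 C0 : 'M[F]_(p2, q1)) (D1 D0 : 'M[F]_(p2, q2)) :
  pencil_at a b (block_mx A1 B1 C1 D1) (block_mx A0 B0 C0 D0) =
  block_mx (pencil_at a b A1 A0) (pencil_at a b B1 B0)
           (pencil_at a b C1 C0) (pencil_at a b D1 D0).
Proof. by rewrite /pencil_at !scale_block_mx opp_block_mx add_block_mx. Qed.

Lemma pencil_at0 p q a b : pencil_at a b (0 : 'M[F]_(p, q)) 0 = 0.
Proof. by rewrite /pencil_at !scaler0 subr0. Qed.

Lemma tr_pencil_at p q a b (M1 M0 : 'M[F]_(p, q)) :
  (pencil_at a b M1 M0)^T = pencil_at a b M1^T M0^T.
Proof. by apply/matrixP=> i j; rewrite !mxE. Qed.

Definition full_column_rank p q (M1 M0 : 'M[F]_(p, q)) : Prop :=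
  forall a b (y : 'cV_q), (a != 0) || (b != 0) -> pencil_at a b M1 M0 *m y = 0 -> y = 0.

Definition column_injective p q (M1 M0 : 'M[F]_(p, q)) : Prop :=
  forall w : 'cV[{poly F}]_q, pencil M1 M0 *m w = 0 -> w = 0.

(** A square pencil of positive size is singular somewhere on the projective line: at
    infinity, or at an eigenvalue of X0 X1^-1. *)
Lemma singular_point r (X1 X0 : 'M[F]_r) : (0 < r)%N ->
  exists a b (u : 'rV_r), [/\ (a != 0) || (b != 0), u != 0
    & u *m pencil_at a b X1 X0 = 0].
Proof.
move=> r0; have sing (Y : 'M[F]_r) : Y \notin unitmx ->
    exists2 u : 'rV_r, u != 0 & u *m Y = 0.
  by rewrite unitmxE unitfE negbK => /det0P.
have [uX|/sing[u u0 uX]] := boolP (X1 \in unitmx); last first.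
  by exists 1, 0, u; rewrite /pencil_at oner_eq0 scale1r scale0r subr0.
have [c /sing[u u0 uc]] := eigenvalue_exists (X0 *m invmx X1) r0.
exists c, 1, u; rewrite oner_eq0 orbT; split=> //.
move/(congr1 (fun z => z *m X1)): uc; rewrite mul0mx -mulmxA mulmxBl mulmxKV //.
by rewrite mul_scalar_mx /pencil_at scale1r -opprB mulmxN => /eqP; rewrite oppr_eq0 => /eqP.
Qed.

(** In the decomposition of the transposed pencil the square part must be empty, since
    a point where it is singular would be a point of rank drop. *)
Lemma full_column_rank_no_eigenvalues p q (M1 M0 : 'M[F]_(p, q)) :
  column_injective M1 M0 -> full_column_rank M1 M0 -> no_eigenvalues (pencil M1 M0).
Proof.
move=> inj full.
have /kronecker_splitting[r [X1 [X0 [s e]]]] : row_injective (CPair M1^T M0^T).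
  move=> v /(congr1 trmx); rewrite trmx_mul tr_pencil !trmxK trmx0 => /inj.
  by move/(congr1 trmx); rewrite trmxK trmx0.
have r0 : r = 0%N.
  apply/eqP; rewrite -leqn0 leqNgt; apply/negP=> /(singular_point X1 X0).
  case=> a [b [u [ab u0 uX]]]; have [S [S' [T [T' [[S1 S2] [T1 T2] /= eL eT]]]]] := e.
  have : row_mx u 0 *m pencil_at a b (S *m M1^T *m T) (S *m M0^T *m T) = 0.
    by rewrite eL eT pencil_at_block mul_row_block uX !pencil_at0 !mulmx0 mul0mx !addr0 row_mx0.
  rewrite pencil_at_mul !mulmxA => /(congr1 (fun z => z *m T')).
  rewrite mul0mx -(mulmxA _ T T') T1 mulmx1 => /(congr1 trmx).
  rewrite trmx_mul trmx0 tr_pencil_at !trmxK => /(full _ _ _ ab).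
  move/(congr1 trmx); rewrite trmxK trmx0 => /(congr1 (fun z => z *m S')).
  rewrite mul0mx -(mulmxA _ S S') S1 mulmx1 => /eqP; rewrite row_mx_eq0 => /andP[].
  by rewrite (negbTE u0).
subst r; have {}e := pequiv_trans e (pequiv_dsum (pequiv_flat0 X1 X0 0 0) (pequiv_refl _)).
have {}e := pequiv_trans e (dsum0p _).
have := pequiv_tr e; rewrite !trmxK !tr_diag_blocks => {}e.
exists (KroneckerData s [::] [::] [::]); split=> //; apply/has_kcfP/(pequiv_trans e).
apply: pequiv_trans (pequiv_sym (dsump0 _)) _; rewrite /kcf_cpair.
by apply: pequiv_dsum (pequiv_refl _) _; apply: pequiv_flat0.
Qed.

(** The kernel vector is (1, -lambda, lambda^2, ...). *)
Lemma L_kernel k : exists2 w : 'cV[{poly F}]_(k.+1), w != 0 & L_pencil F k *m w = 0.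
Proof.
exists (\col_j (- 'X) ^+ j).
  by apply/eqP=> /colP/(_ 0)/eqP; rewrite !mxE expr0 oner_eq0.
apply/colP=> i; rewrite !mxE.
under eq_bigr do rewrite !mxE.
rewrite (bigD1 (widen_ord (leqnSn k) i)) //= eqxx (bigD1 (lift ord0 i)) /=; last first.
  by rewrite -val_eqE /= /bump leq0n add1n gtn_eqF.
rewrite /bump leq0n add1n eqxx gtn_eqF // mul1r big1 ?addr0.
  by rewrite exprS mulNr addrN.
move=> j /andP[j1 j2].
have -> : (j == i :> nat) = false by apply/negbTE.
have -> : (j == i.+1 :> nat) = false by apply/negbTE; rewrite -(lift0 i).
by rewrite mul0r.
Qed.

(** Row i of the equation reads a y_i + b y_(i-1) = 0 with y_(-1) = y_k = 0, which is
    solved upwards from y_0 if a is nonzero; otherwise each row gives b y_(i-1) = 0. *)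
Lemma LT_full k : full_column_rank (L_lead F k)^T (L_tail F k)^T.
Proof.
move=> a b y ab /colP ey.
have {}ey (i : 'I_k.+1) :
    \sum_(l < k) (a * (i == l :> nat)%:R + b * (i == l.+1 :> nat)%:R) * y l 0 = 0.
  have := ey i; rewrite [in RHS]mxE => {2}<-; rewrite mxE; apply: eq_bigr => l _.
  by rewrite !mxE mulrN opprK.
have [a0|a0] := eqVneq a 0.
  apply/colP=> j; rewrite mxE; have := ey (lift ord0 j); rewrite (bigD1 j) //= big1.
    rewrite a0 mul0r add0r addr0 /bump leq0n add1n eqxx mulr1 => /eqP.
    by rewrite mulf_eq0; move: ab; rewrite a0 eqxx => /negbTE -> /eqP.
  move=> l ne; rewrite a0 mul0r add0r /bump leq0n add1n eqSS eq_sym.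
  by rewrite -val_eqE /= in ne; rewrite (negbTE ne) mulr0 mul0r.
suff H m : forall j : 'I_k, j = m :> nat -> y j 0 = 0.
  by apply/colP=> j; rewrite mxE; apply: H.
elim/ltn_ind: m => m IH j ej; have := ey (widen_ord (leqnSn k) j).
rewrite (bigD1 j) //= big1.
  rewrite eqxx ltn_eqF // mulr0 !addr0 mulr1 => /eqP.
  by rewrite mulf_eq0 (negbTE a0) => /eqP.
move=> l ne; have -> : (j == l :> nat) = false by apply/negbTE; rewrite eq_sym.
case: eqP => [e|_]; last by rewrite !mulr0 addr0 mul0r.
by rewrite (IH l) ?mulr0 // -ej e.
Qed.

Lemma LT_sum_full s : full_column_rank (lead (LT_sum F s)) (tail (LT_sum F s)).
Proof.
move=> a b y ab; elim: s y => [|k s IH] y /=; first by rewrite [y]flatmx0.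
rewrite -[y]vsubmxK pencil_at_block !pencil_at0 mul_block_col !mul0mx addr0 add0r.
move/eqP; rewrite col_mx_eq0 => /andP[/eqP e1 /eqP e2].
by rewrite (LT_full ab e1) (IH _ e2) col_mx0.
Qed.

(** Without eigenvalues only blocks L_k and L_k^T occur.  The former have polynomial
    kernel vectors, which column injectivity excludes, and the latter have full
    column rank at every point. *)
Lemma no_eigenvalues_full_column_rank p q (M1 M0 : 'M[F]_(p, q)) :
  column_injective M1 M0 -> no_eigenvalues (pencil M1 M0) -> full_column_rank M1 M0.
Proof.
move=> inj [[ls fs ifs rs] [/has_kcfP + /esym/eqP]].
rewrite addn_eq0 => + /andP[/eqP f0 /eqP i0].
case=> [S [S' [T [T' [[S1 S2] [T1 T2]]]]]].
case: rs f0 i0 S S' T T' S1 S2 T1 T2 => [|k rs] f0 i0 S S' T T' S1 S2 T1 T2 eL eT; last first.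
  have [w w0 kw] := L_kernel k.
  pose W := col_mx 0 (col_mx 0 (col_mx 0 (col_mx w 0))) :
    'cV[{poly F}]_(width (kcf_cpair (KroneckerData ls fs ifs (k :: rs)))).
  have : pencil M1 M0 *m (cst_mx T *m W) = 0.
    have := pencil_mul S T M1 M0; rewrite eL eT => /(congr1 (mulmx (cst_mx S'))).
    rewrite -(mulmxA (cst_mx S)) mulmxA -cst_mxM S2 cst_mx1 mul1mx mulmxA => ->.
    rewrite /= !pencil_block !pencil00 -L_pencilE /W -mulmxA.
    by rewrite !mul_block_col !(mulmx0, mul0mx, addr0, add0r, kw, col_mx0).
  move/inj/(congr1 (fun z => cst_mx T' *m z)).
  rewrite mulmxA -cst_mxM T2 cst_mx1 mul1mx mulmx0 => /eqP.
  by rewrite !col_mx_eq0 (negbTE w0) !andbF.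
move=> a b y ab e.
have : pencil_at a b (S *m M1 *m T) (S *m M0 *m T) *m (T' *m y) = 0.
  by rewrite pencil_at_mul -!mulmxA (mulmxA T) T1 mul1mx e mulmx0.
move: eL eT => /= -> -> eK; suff : T' *m y = 0.
  by move/(congr1 (mulmx T)); rewrite mulmxA T1 mul1mx mulmx0.
have empty n (z : 'cV[F]_n) : n = 0%N -> z = 0 by move=> n0; subst n; apply: flatmx0.
move: eK; move: (T' *m y) => z; rewrite -[z]vsubmxK.
rewrite (empty _ (dsubmx z)); last first.
  by move: f0 i0; rewrite /kcf_rf /kcf_rinf /= => -> ->.
rewrite pencil_at_block !pencil_at0 mul_block_col !(mulmx0, mul0mx, addr0, add0r).
move/eqP; rewrite col_mx_eq0 eqxx andbT => /eqP/(LT_sum_full ab) ->.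
by rewrite col_mx0.
Qed.

End ClosedField.

(** * Unitary reduction to block triangular form *)

Section UnitaryReduction.
Variable C : numClosedFieldType.
Local Open Scope sesquilinear_scope.
Let mx_simp := (mulmx0, mul0mx, mul1mx, mulmx1, addr0, add0r).

Lemma adjmxM p q k (M : 'M[C]_(p, q)) (N : 'M[C]_(q, k)) :
  (M *m N)^t* = N^t* *m M^t*.
Proof. by rewrite trmx_mul map_mxM. Qed.

Lemma adjmx0 p q : (0 : 'M[C]_(p, q))^t* = 0.
Proof. by rewrite trmx0 map_mx0. Qed.

Lemma adjmx1 p : (1%:M : 'M[C]_p)^t* = 1%:M.
Proof. by rewrite trmx1 map_mx1. Qed.

Lemma adj_row_mx p q k (M : 'M[C]_(p, q)) (N : 'M[C]_(p, k)) :
  (row_mx M N)^t* = col_mx (M^t*) (N^t*).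
Proof. by rewrite tr_row_mx map_col_mx. Qed.

Lemma adj_col_mx p q k (M : 'M[C]_(p, q)) (N : 'M[C]_(k, q)) :
  (col_mx M N)^t* = row_mx (M^t*) (N^t*).
Proof. by rewrite tr_col_mx map_row_mx. Qed.

Lemma mulmx1C_size a b (S : 'M[C]_(a, b)) S' :
  a = b -> S *m S' = 1%:M -> S' *m S = 1%:M.
Proof. by move=> e; case: b / e S S' => S S'; apply: mulmx1C. Qed.

Lemma kernel_orthonormal k r h (M : 'M[C]_(k, r)) : (h + r <= k)%N ->
  exists N : 'M_(h, k), N *m N^t* = 1%:M /\ N *m M = 0.
Proof.
move=> le; pose K := row_base (kermx M).
have leh : (h <= \rank (kermx M))%N.
  rewrite mxrank_ker leq_subRL.
    by apply: leq_trans le; rewrite addnC leq_add2l rank_leq_col.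
  exact: rank_leq_row.
pose N0 : 'M_(h, k) := pid_mx h *m K.
have fN0 : row_free N0.
  by rewrite /row_free mxrankMfree ?row_base_free // rank_pid_mx.
exists (schmidt N0); split.
  by apply/unitarymxP/schmidt_unitarymx; apply: leq_trans le; rewrite leq_addr.
apply/sub_kermxP; rewrite eqmx_schmidt_free //.
by apply: submx_trans (submxMl _ _) _; rewrite eq_row_base.
Qed.

Lemma orthonormal_completion h k (Z : 'M[C]_(h, h + k)) : Z *m Z^t* = 1%:M ->
  exists N : 'M_(k, h + k), [/\ N *m N^t* = 1%:M, N *m Z^t* = 0
    & Z^t* *m Z + N^t* *m N = 1%:M].
Proof.
move=> ZZ; have [|N [NN NZ]] := @kernel_orthonormal (h + k) h k (Z^t*).
  by rewrite addnC.
exists N; split=> //; rewrite -mul_row_col -adj_col_mx; apply: mulmx1C.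
rewrite adj_col_mx mul_col_row ZZ NN NZ -[Z *m N^t*]trmxCK adjmxM trmxCK NZ adjmx0.
by rewrite -scalar_mx_block.
Qed.

Lemma lower_inverse a b (x p : 'M[C]_a) (z q : 'M[C]_(b, a)) (w s : 'M[C]_b) y :
  block_mx x 0 z w *m block_mx p y q s = 1%:M ->
  [/\ y = 0, x *m p = 1%:M & w *m s = 1%:M].
Proof.
rewrite mulmx_block !mx_simp scalar_mx_block => /eq_block_mx[xp xy _ zy].
have y0 : y = 0 by rewrite -[y]mul1mx -(mulmx1C xp) -mulmxA xy mulmx0.
by move: zy; rewrite y0 mulmx0 add0r.
Qed.

(** The first rows of S are combinations of the first rows of the orthonormalized
    matrix, which are orthogonal to the others. *)
Lemma schmidt_lower a b k (S : 'M[C]_(a + b, k)) : (a + b <= k)%N ->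
  exists x z w, S = block_mx x 0 z w *m schmidt S.
Proof.
move=> le; pose L := S *m (schmidt S)^t*.
have SS := unitarymxP (schmidt_unitarymx S le).
have eS : S = L *m schmidt S.
  have /submxP[D eD] := schmidt_sub S.
  by rewrite {1}eD /L {2}eD -(mulmxA D) SS mulmx1.
have : (usubmx S <= usubmx (schmidt S))%MS.
  apply/row_subP=> i; rewrite row_usubmx; apply: submx_trans (row_schmidt_sub _ _) _.
  apply/sumsmx_subP=> j le_ji; rewrite genmxE.
  have lt : (j < a)%N by apply: leq_ltn_trans le_ji (ltn_ord i).
  have -> : j = lshift b (Ordinal lt) by apply: val_inj.
  by rewrite -row_usubmx row_sub.
case/submxP=> x ex.
have ur0 : ursubmx L = 0.
  rewrite /L; move: (schmidt S) SS ex => Y SS ex.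
  rewrite -[S]vsubmxK -[Y]vsubmxK adj_col_mx mul_col_row block_mxKur ex.
  move: SS; rewrite -{1 2}[Y]vsubmxK adj_col_mx mul_col_row scalar_mx_block.
  by case/eq_block_mx=> _ Y12 _ _; rewrite -mulmxA Y12 mulmx0.
exists (ulsubmx L), (dlsubmx L), (drsubmx L).
by rewrite {1}eS -{1}[L]submxK ur0.
Qed.

(** If S P T = diag(X, Q), then P is S^-1 diag(X, Q) T^-1; once the unitary factors of
    S and T^-1 are moved to P, only block lower triangular factors remain around
    diag(X, Q), and their diagonal blocks act on X and Q by strict equivalence. *)
Lemma unitary_block_triangular r c k (P1 P0 : 'M[C]_(r + c, (r + c) + k))
    (X1 X0 : 'M[C]_r) (Q1 Q0 : 'M[C]_(c, c + k)) :
  CPair P1 P0 ~~~ dsum (CPair X1 X0) (CPair Q1 Q0) ->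
  exists U (W : 'M[C]_((r + c) + k, r + (c + k))) (X1' X0' : 'M_r)
      (Y1 Y0 : 'M_(c, r)) (Q1' Q0' : 'M_(c, c + k)),
    [/\ U *m U^t* = 1%:M, W *m W^t* = 1%:M /\ W^t* *m W = 1%:M,
        U *m P1 *m W = block_mx X1' 0 Y1 Q1',
        U *m P0 *m W = block_mx X0' 0 Y0 Q0'
      & CPair X1' X0' ~~~ CPair X1 X0 /\ CPair Q1' Q0' ~~~ CPair Q1 Q0].
Proof.
rewrite {1}/pequiv /= => -[S [S' [T [T' [[S1 S2] [T1 T2] e1 e0]]]]].
pose U := schmidt S; pose Y := schmidt T'.
have UU : U *m U^t* = 1%:M by apply/unitarymxP/schmidt_unitarymx.
have le : (r + (c + k) <= (r + c) + k)%N by rewrite addnA.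
have YY : Y *m Y^t* = 1%:M by apply/unitarymxP/schmidt_unitarymx.
have YY' := mulmx1C_size (addnA r c k) YY.
have [x [z [w eS]]] := schmidt_lower S (leqnn _).
have [x' [z' [w' eT]]] := schmidt_lower T' le.
have : block_mx x 0 z w *m (U *m S') = 1%:M by rewrite mulmxA -eS.
rewrite -[U *m S']submxK => /lower_inverse[ur xp ws].
have TY : block_mx x' 0 z' w' = T' *m Y^t* by rewrite {1}eT -mulmxA YY mulmx1.
have : block_mx x' 0 z' w' *m (Y *m T) = 1%:M by rewrite mulmxA -eT.
rewrite -[Y *m T]submxK => /lower_inverse[_ x'p w's].
have red P X Q : S *m P *m T = block_mx X 0 0 Q -> U *m P *m Y^t* =
    block_mx (ulsubmx (U *m S') *m X *m x') 0
      (dlsubmx (U *m S') *m X *m x' + drsubmx (U *m S') *m Q *m z')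
      (drsubmx (U *m S') *m Q *m w').
  move=> eP; have -> : P = S' *m (S *m P *m T) *m T'.
    by rewrite !mulmxA S2 mul1mx -mulmxA T1 mulmx1.
  rewrite eP !mulmxA -mulmxA -TY -[in LHS](submxK (U *m S')) ur.
  by rewrite !mulmx_block !mx_simp.
exists U, (Y^t*); do 6!eexists; split.
- exact: UU.
- by rewrite trmxCK.
- exact: red e1.
- exact: red e0.
split; apply: pequiv_sym.
  apply: (@pequiv_mul _ _ _ _ _ _ x _ (ulsubmx (Y *m T))); split=> //; exact: mulmx1C.
apply: (@pequiv_mul _ _ _ _ _ _ w _ (drsubmx (Y *m T))); split=> //; exact: mulmx1C.
Qed.

End UnitaryReduction.

(** * The special form of the column transformation *)

Section Compression.
Variable K : numClosedFieldType.
Local Open Scope sesquilinear_scope.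
Let mx_simp := (mulmx0, mul0mx, mul1mx, mulmx1, addr0, add0r).

(** Write W0 = [Ma Mb; Na Nb].  As Ma has only r columns, there are c orthonormal rows
    V2 with V2 Ma = 0; then Z = V2 Mb again has orthonormal rows.  Mixing the last
    c + n columns by Z^* and an orthonormal complement N^* and multiplying on the left
    by diag(V^*, I), where V^* ends with V2, makes the middle row of blocks
    [0 I 0], and orthogonality of the columns makes the middle column [0; I; 0]. *)
Lemma unitary_special_form r c n (W0 : 'M[K]_((r + c) + n, r + (c + n))) :
  W0 *m W0^t* = 1%:M -> W0^t* *m W0 = 1%:M ->
  exists (V : 'M_(r + c)) (T2 : 'M_(c + n, c)) (T3 : 'M_(c + n, n))
         (W11 : 'M_r) (W13 : 'M_(r, n)) (W31 : 'M_(n, r)) (W33 : 'M_n),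
    let Wt := row_mx (row_mx (lsubmx W0) (rsubmx W0 *m T2)) (rsubmx W0 *m T3) in
    let W := block3_mx W11 0 W13 0 1%:M 0 W31 0 W33 in
    [/\ V \is unitarymx, W \is unitarymx, row_mx T2 T3 \in unitmx
      & Wt = block_mx V 0 0 1%:M *m W].
Proof.
move=> WW WW'.
pose Ma := usubmx (lsubmx W0); pose Na := dsubmx (lsubmx W0).
pose Mb := usubmx (rsubmx W0); pose Nb := dsubmx (rsubmx W0).
have eWa : lsubmx W0 = col_mx Ma Na by rewrite vsubmxK.
have eWb : rsubmx W0 = col_mx Mb Nb by rewrite vsubmxK.
have [MM NM] : Ma *m Ma^t* + Mb *m Mb^t* = 1%:M /\ Na *m Ma^t* + Nb *m Mb^t* = 0.
  have : row_mx (lsubmx W0) (rsubmx W0) *m (row_mx (lsubmx W0) (rsubmx W0))^t* = 1%:M.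
    by rewrite hsubmxK.
  rewrite eWa eWb adj_row_mx mul_row_col !adj_col_mx !mul_col_row add_block_mx scalar_mx_block.
  by case/eq_block_mx.
have [|V2 [V22 V2M]] := @kernel_orthonormal K (r + c) r c Ma; first by rewrite addnC.
have [|V1 [V11 V12]] := @kernel_orthonormal K (r + c) c r (V2^t*); first by [].
have V21 : V2 *m V1^t* = 0 by rewrite -[LHS]trmxCK adjmxM trmxCK V12 adjmx0.
pose Z := V2 *m Mb.
have MbMb : Mb *m Mb^t* = 1%:M - Ma *m Ma^t* by rewrite -MM addrAC subrr add0r.
have MaV2 : Ma^t* *m V2^t* = 0 by rewrite -adjmxM V2M adjmx0.
have MbZ : Mb *m Z^t* = V2^t*.
  by rewrite adjmxM mulmxA MbMb mulmxBl mul1mx -mulmxA MaV2 mulmx0 subr0.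
have NbZ : Nb *m Z^t* = 0.
  rewrite adjmxM mulmxA; have -> : Nb *m Mb^t* = - (Na *m Ma^t*).
    by apply/eqP; rewrite -addr_eq0 addrC NM.
  by rewrite mulNmx -mulmxA MaV2 mulmx0 oppr0.
have ZZ : Z *m Z^t* = 1%:M by rewrite -mulmxA MbZ V22.
have [N [NN1 NZ ZN]] := orthonormal_completion ZZ.
have ZN0 : Z *m N^t* = 0 by rewrite -[LHS]trmxCK adjmxM trmxCK NZ adjmx0.
pose Vs := col_mx V1 V2.
have VV : Vs *m Vs^t* = 1%:M.
  by rewrite adj_col_mx mul_col_row V11 V12 V21 V22 -scalar_mx_block.
have uVs : Vs \is unitarymx by apply/unitarymxP.
exists (Vs^t*), (Z^t*), (N^t*), (V1 *m Ma), (V1 *m Mb *m N^t*), Na, (Nb *m N^t*).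
move=> Wt W.
have eW : W = block_mx Vs 0 0 1%:M *m Wt.
  rewrite /W /Wt /block3_mx eWa eWb !(mul_col_mx Mb) MbZ NbZ.
  rewrite -[row_mx (col_mx _ _) (col_mx _ _)]block_mxEh (block_mxEv Ma) -block_mxEh.
  by rewrite mulmx_block !mx_simp /Vs mul_col_row (mul_col_mx V1) !mulmxA V12 V22 V2M -/Z ZN0.
(* From here on Z must not be unfolded, as adjoints of products are expanded. *)
clearbody Z.
have WtWt : Wt *m Wt^t* = 1%:M.
  rewrite /Wt !adj_row_mx !mul_row_col !adjmxM !trmxCK -addrA.
  rewrite !mulmxA -!(mulmxA (rsubmx W0)) -mulmxDr -mulmxDl ZN mul1mx.
  by rewrite -mul_row_col -adj_row_mx hsubmxK.
have DD : block_mx (Vs^t*) 0 0 1%:M *m block_mx Vs 0 0 1%:M = 1%:M :> 'M_(r + c + n).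
  by rewrite mulmx_block !mx_simp (mulmx1C VV) -scalar_mx_block.
have uD : block_mx Vs 0 0 1%:M \is @unitarymx K (r + c + n) (r + c + n).
  apply/unitarymxP; rewrite -[RHS](mulmx1C DD); congr (_ *m _).
  by rewrite tr_block_mx map_block_mx !adjmx0 adjmx1.
split.
- by rewrite trmxC_unitary.
- by rewrite eW; apply: mul_unitarymx => //; apply/unitarymxP.
- have : row_mx (Z^t*) (N^t*) *m col_mx Z N = 1%:M by rewrite mul_row_col.
  by case/mulmx1_unit.
by rewrite eW mulmxA DD mul1mx.
Qed.

(** B W33 is A w plus a combination of the columns A V2, so that A^-1 B W33 is
    w + V2 Ac^-1 Bc; the contribution of w is then part of the new direct term. *)
Lemma transfer_compression (L : fieldType) d c m n (A U : 'M[L]_d) (B w : 'M[L]_(d, n))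
    (C : 'M[L]_(m, d)) (D : 'M[L]_(m, n)) (Ac : 'M[L]_c) (Bc : 'M[L]_(c, n))
    (V2 : 'M[L]_(d, c)) (W33 : 'M[L]_n) (E : 'M[L]_(d, c)) :
  A \in unitmx -> Ac \in unitmx -> U \in unitmx ->
  U *m (A *m V2) = E *m Ac -> U *m (A *m w - B *m W33) = - (E *m Bc) ->
  (C *m invmx A *m B + D) *m W33 =
  C *m V2 *m invmx Ac *m Bc + (C *m w + D *m W33).
Proof.
move=> uA uAc uU eAc eBc.
have : A *m w - B *m W33 = - (A *m V2 *m invmx Ac *m Bc).
  apply: (can_inj (mulKmx uU)); rewrite eBc mulmxN !mulmxA -(mulmxA U) eAc.
  by rewrite mulmxK.
move/(congr1 (mulmx (invmx A))); rewrite mulmxBr mulmxN !mulmxA mulVmx // !mul1mx => e.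
have {e} : invmx A *m B *m W33 = w + V2 *m invmx Ac *m Bc.
  by rewrite -[V2 *m _ *m _]opprK -e opprB addrC subrK.
move=> e; rewrite mulmxDl -!mulmxA (mulmxA (invmx A)) e mulmxDr !mulmxA.
by rewrite addrA [C *m w + _]addrC.
Qed.

End Compression.

(** * Removal of the eigenvalues *)

Section Deflation.
Variable K : numClosedFieldType.
Local Open Scope sesquilinear_scope.
Let mx_simp := (mulmx0, mul0mx, mul1mx, mulmx1, addr0, add0r).

Lemma cst_row_mx p q k (M : 'M[K]_(p, q)) (N : 'M_(p, k)) :
  cst_mx (row_mx M N) = row_mx (cst_mx M) (cst_mx N).
Proof. exact: map_row_mx. Qed.

Lemma cst_col_mx p q k (M : 'M[K]_(p, q)) (N : 'M_(k, q)) :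
  cst_mx (col_mx M N) = col_mx (cst_mx M) (cst_mx N).
Proof. exact: map_col_mx. Qed.

Lemma cst_mx_unit p (M : 'M[K]_p) : M \in unitmx -> cst_mx M \in unitmx.
Proof.
move=> uM; have : cst_mx M *m cst_mx (invmx M) = 1%:M by rewrite -cst_mxM mulmxV // cst_mx1.
by case/mulmx1_unit.
Qed.

Lemma cst_unitary_unit p (M : 'M[K]_p) : M \is unitarymx -> cst_mx M \in unitmx.
Proof. by move/unitarymx_unit/cst_mx_unit. Qed.

Lemma rat_mxM p q k (M : 'M[{poly K}]_(p, q)) (N : 'M_(q, k)) :
  rat_mx (M *m N) = rat_mx M *m rat_mx N.
Proof. exact: map_mxM. Qed.

Lemma rat_mx_unit p (M : 'M[{poly K}]_p) : \det M != 0 -> rat_mx M \in unitmx.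
Proof. by rewrite unitmxE unitfE /rat_mx det_map_mx tofrac_eq0. Qed.

Lemma column_injective_col_mx p p' q (A1 A0 : 'M[K]_(p, q)) (C1 C0 : 'M_(p', q)) :
  (forall w : 'cV_q, pencil A1 A0 *m w = 0 -> w = 0) ->
  column_injective (col_mx A1 C1) (col_mx A0 C0).
Proof.
move=> inj w; rewrite pencil_col mul_col_mx => /eqP.
by rewrite col_mx_eq0 => /andP[/eqP /inj].
Qed.

(** A kernel vector y of [Ac; Cc] at some point yields the kernel vector V2 y of
    [A; C] at the same point. *)
Lemma full_column_rank_restrict d c m (A1 A0 U : 'M[K]_d) (C1 C0 : 'M_(m, d))
    (V2 : 'M_(d, c)) (E : 'M_(d, c)) (Ac1 Ac0 : 'M_c) (Cc1 Cc0 : 'M_(m, c)) :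
  (forall y : 'cV_c, V2 *m y = 0 -> y = 0) -> U \in unitmx ->
  U *m A1 *m V2 = E *m Ac1 -> U *m A0 *m V2 = E *m Ac0 ->
  C1 *m V2 = Cc1 -> C0 *m V2 = Cc0 ->
  full_column_rank (col_mx A1 C1) (col_mx A0 C0) ->
  full_column_rank (col_mx Ac1 Cc1) (col_mx Ac0 Cc0).
Proof.
move=> injV uU e1 e0 f1 f0 full a b y ab.
rewrite /pencil_at !scale_col_mx opp_col_mx add_col_mx mul_col_mx => /eqP.
rewrite col_mx_eq0 => /andP[/eqP eA /eqP eC].
apply/injV/(full _ _ _ ab).
rewrite /pencil_at !scale_col_mx opp_col_mx add_col_mx mul_col_mx.
have -> : (a *: C1 - b *: C0) *m (V2 *m y) = 0.
  by rewrite mulmxA mulmxBl -!scalemxAl f1 f0.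
have -> : (a *: A1 - b *: A0) *m (V2 *m y) = 0; last by rewrite col_mx0.
apply: (can_inj (mulKmx uU)); rewrite mulmx0 !mulmxA mulmxBr mulmxBl.
by rewrite -!scalemxAr -!scalemxAl e1 e0 !scalemxAr -mulmxBr -mulmxA eA mulmx0.
Qed.

Lemma is_pencil_oppr p q (P : 'M[{poly K}]_(p, q)) : is_pencil P -> is_pencil (- P).
Proof.
case=> M1 [M0 ->]; exists (- M1), (- M0).
by apply/matrixP=> i j; rewrite !mxE !polyCN mulrN opprD.
Qed.

Lemma is_pencil_mulr p q k (P : 'M[{poly K}]_(p, q)) (T : 'M_(q, k)) :
  is_pencil P -> is_pencil (P *m cst_mx T).
Proof. by case=> M1 [M0 ->]; exists (M1 *m T), (M0 *m T); rewrite pencil_mulr. Qed.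

Lemma unitmx_det_neq0 p (M : 'M[{poly K}]_p) : M \in unitmx -> \det M != 0.
Proof. by rewrite unitmxE; apply: contraTneq => ->; rewrite unitr0. Qed.

(** The theorem for the sizes r + c and with the decomposition of [A, -B] given, so
    that no casts are needed. *)
Lemma deflation r c m n
    (A1 A0 : 'M[K]_(r + c)) (B1 B0 : 'M_(r + c, n))
    (C1 C0 : 'M_(m, r + c)) (D1 D0 : 'M_(m, n))
    (X1 X0 : 'M_r) (Q1 Q0 : 'M_(c, c + n)) s
    (A := pencil A1 A0) (B := pencil B1 B0) (C := pencil C1 C0) (D := pencil D1 D0) :
  regular A -> \det (pencil X1 X0) != 0 -> CPair Q1 Q0 ~~~ L_sum s ->
  CPair (row_mx A1 (- B1)) (row_mx A0 (- B0)) ~~~ dsum (CPair X1 X0) (CPair Q1 Q0) ->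
  exists (U V : 'M[K]_(r + c)) (W11 : 'M_r) (W13 : 'M_(r, n))
      (W31 : 'M_(n, r)) (W33 : 'M_n)
      (X : 'M[{poly K}]_r) (Y : 'M_(c, r)) (Z : 'M_(m, r))
      (Ac : 'M_c) (Bc : 'M_(c, n)) (Cc : 'M_(m, c)) (Dc : 'M_(m, n)),
    let W := block3_mx W11 0 W13 0 1%:M 0 W31 0 W33 in
    [/\ [/\ U \is unitarymx, V \is unitarymx & W \is unitarymx],
        [/\ block_mx (cst_mx U) 0 0 1%:M *m block_mx A (- B) C D
              *m block_mx (cst_mx V) 0 0 1%:M *m cst_mx W
            = block3_mx X 0 0 Y Ac (- Bc) Z Cc Dc,
            number_of_eigenvalues (row_mx A (- B)) r,
            is_pencil X
          & regular X]
      & [/\ same_eigenvalues (row_mx A (- B)) X,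
            no_eigenvalues (row_mx Ac (- Bc)),
            realizes Ac Bc Cc Dc (transfer A B C D *m rat_mx (cst_mx W33))
              /\ W33 \in unitmx
          & no_eigenvalues (col_mx A C) -> no_eigenvalues (col_mx Ac Cc)]].
Proof.
move=> regA regX eQ eP.
have ePQ : row_mx A (- B) = pencil (row_mx A1 (- B1)) (row_mx A0 (- B0)).
  by rewrite pencil_row; congr row_mx; apply/matrixP=> i j; rewrite !mxE !polyCN mulrN -opprD.
have [U [W0 [X1' [X0' [Y1 [Y0 [Q1' [Q0' [UU [WW WW'] e1 e0 [eX eQ']]]]]]]]]] :=
  unitary_block_triangular eP.
have [V [T2 [T3 [W11 [W13 [W31 [W33 [uV uW uT eWt]]]]]]]] := unitary_special_form WW WW'.
set Wt := row_mx _ _ in eWt; set W := block3_mx _ _ _ _ _ _ _ _ _ in uW eWt.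
have uU : U \is unitarymx by apply/unitarymxP.
pose X := pencil X1' X0'; pose Y := pencil Y1 Y0.
pose Q := pencil Q1' Q0'.
pose Ac := Q *m cst_mx T2; pose Bc := - (Q *m cst_mx T3).
pose G := row_mx C D.
pose Z := G *m cst_mx (lsubmx W0); pose Cc := G *m cst_mx (rsubmx W0 *m T2).
pose Dc := G *m cst_mx (rsubmx W0 *m T3).
have eXY : cst_mx U *m row_mx A (- B) *m cst_mx (lsubmx W0) = col_mx X Y.
  by rewrite ePQ pencil_mul !mulmx_lsub e1 e0 !block_mxEh !row_mxKl pencil_col.
have eQQ : cst_mx U *m row_mx A (- B) *m cst_mx (rsubmx W0) = col_mx 0 Q.
  by rewrite ePQ pencil_mul !mulmx_rsub e1 e0 !block_mxEh !row_mxKr pencil_col pencil00.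
have e2 : cst_mx U *m row_mx A (- B) *m cst_mx (rsubmx W0 *m T2) = col_mx 0 Ac.
  by rewrite cst_mxM mulmxA eQQ mul_col_mx mul0mx.
have e3 : cst_mx U *m row_mx A (- B) *m cst_mx (rsubmx W0 *m T3) = col_mx 0 (- Bc).
  by rewrite cst_mxM mulmxA eQQ mul_col_mx mul0mx opprK.
(* The middle and last block columns of diag(V, I) W; the middle one is (V2; 0), which
   is why A V2 and C V2 alone give Ac and Cc. *)
pose E : 'M[K]_(r + c, c) := col_mx 0 1%:M; pose V2 := V *m E.
pose w := V *m col_mx W13 0.
have [eW2 eW3] : rsubmx W0 *m T2 = col_mx V2 0 /\ rsubmx W0 *m T3 = col_mx w W33.
  move: eWt; rewrite /Wt /W /block3_mx mulmx_block !mx_simp (block_mxEh (V *m _)).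
  case/eq_row_mx=> + ->; rewrite (block_mxEh W11) mul_mx_row -block_mxEv block_mxEh.
  by case/eq_row_mx=> _ ->.
have eA2 : cst_mx U *m A *m cst_mx V2 = col_mx 0 Ac.
  by rewrite -e2 eW2 cst_col_mx cst_mx0 -!mulmxA mul_row_col mulmx0 addr0.
have eC2 : C *m cst_mx V2 = Cc.
  by rewrite /Cc /G eW2 cst_col_mx cst_mx0 mul_row_col mulmx0 addr0.
have eA3 : cst_mx U *m (A *m cst_mx w - B *m cst_mx W33) = col_mx 0 (- Bc).
  by rewrite -e3 eW3 cst_col_mx -mulmxA mul_row_col mulNmx.
have eC3 : C *m cst_mx w + D *m cst_mx W33 = Dc.
  by rewrite /Dc /G eW3 cst_col_mx mul_row_col.
have uU' := cst_unitary_unit uU; have uV' := cst_unitary_unit uV.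
pose M := cst_mx U *m A *m cst_mx V.
have detM : \det M != 0.
  by rewrite !det_mulmx !mulf_neq0 // unitmx_det_neq0.
(* The middle column shows that U A V is block triangular with Ac on the diagonal. *)
have eM : M = block_mx (ulsubmx M) 0 (dlsubmx M) Ac.
  have : M *m cst_mx E = col_mx 0 Ac by rewrite -eA2 cst_mxM !mulmxA.
  rewrite -{1 2}[M]submxK cst_col_mx cst_mx0 cst_mx1 mul_block_col !mx_simp.
  by case/eq_col_mx=> <- <-.
have [det11 regAc] : \det (ulsubmx M) != 0 /\ regular Ac.
  by apply/andP; rewrite -negb_or -mulf_eq0 -(det_lblock _ (dlsubmx M)) -eM.
(* If W33 x = 0, the first block row gives M11 W13 x = 0, so W13 x = 0, and the last
   block column of W kills x. *)
have uW33 : W33 \in unitmx.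
  rewrite -unitmx_tr -row_free_unit; apply: inj_row_free => v.
  move/(congr1 trmx); rewrite trmx_mul trmxK trmx0 => xW33.
  have : M *m cst_mx (col_mx (W13 *m v^T) 0) = col_mx 0 (- Bc *m cst_mx v^T).
    have := congr1 (mulmxr (cst_mx v^T)) eA3.
    rewrite /= -[X in X = _]mulmxA mulmxBl -!(mulmxA _ _ (cst_mx _)) -!cst_mxM xW33.
    rewrite cst_mx0 mulmx0 subr0 mul_col_mx mul0mx => <-.
    by rewrite /w -(mulmxA V) mul_col_mx mul0mx !mulmxA.
  rewrite eM cst_col_mx cst_mx0 mul_block_col !mx_simp => /eq_col_mx[+ _].
  move/(det_neq0_mulmx0 det11); rewrite -(cst_mx0 K) => /cst_mx_inj xW13.
  have : W *m col_mx 0 v^T = 0.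
    by rewrite /W /block3_mx mul_block_col !mx_simp (mul_col_mx W13) xW13 xW33 mul0mx !col_mx0.
  move/(congr1 (mulmx (invmx W))); rewrite mulKmx ?unitarymx_unit // mulmx0 => /eqP.
  by rewrite col_mx_eq0 => /andP[_ /eqP/(congr1 trmx)]; rewrite trmxK trmx0.
have [nE sE] := regular_plus_L_eigenvalues regX eX
  (pequiv_trans eP (pequiv_dsum (pequiv_refl _) eQ)).
rewrite -ePQ in nE sE.
have eAc : Ac = pencil (Q1' *m T2) (Q0' *m T2) by rewrite -pencil_mulr.
exists U, V, W11, W13, W31, W33, X, Y, Z, Ac, Bc, Cc, Dc; move=> W'; split.
- by split.
- split=> //; last 2 first.
  + by exists X1', X0'.
  + apply: det_neq0P; apply: (pequiv_row_injective (pequiv_sym eX)).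
    by move=> v; apply: det_neq0_mul0mx.
  have -> : block_mx (cst_mx V) 0 0 1%:M = cst_mx (block_mx V 0 0 1%:M).
    by move=> k; rewrite [RHS]map_block_mx !map_mx0 map_mx1.
  rewrite -mulmxA -cst_mxM -eWt mulmx_block !mx_simp block_mxEv -mul_mx_row mul_col_mx.
  rewrite /Wt !cst_row_mx !(mul_mx_row (cst_mx U *m _)) eXY e2 e3 !(mul_mx_row (row_mx C D)).
  by rewrite /block3_mx -(block_mxEh X) -block_mxEv.
split=> //.
- have -> : row_mx Ac (- Bc) = pencil (Q1' *m row_mx T2 T3) (Q0' *m row_mx T2 T3).
    by rewrite -pencil_mulr cst_row_mx mul_mx_row opprK.
  apply: (@L_sum_no_eigenvalues _ _ _ _ _ s); apply: pequiv_trans _ eQ.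
  apply: pequiv_trans _ eQ'; apply: pequiv_sym.
  have := pequiv_mul Q1' Q0' (two_sided_inverse1 K c) (two_sided_inverse_unit uT).
  by rewrite !mul1mx.
- split=> //; split.
    have pG : is_pencil G by exists (row_mx C1 D1), (row_mx C0 D0); rewrite pencil_row.
    have pQ : is_pencil Q by exists Q1', Q0'.
    by split=> //; try apply: is_pencil_oppr; apply: is_pencil_mulr.
  have rB p q (P N : 'M[{poly K}]_(p, q)) : rat_mx (P - N) = rat_mx P - rat_mx N.
    exact: map_mxB.
  have rD p q (P N : 'M[{poly K}]_(p, q)) : rat_mx (P + N) = rat_mx P + rat_mx N.
    exact: map_mxD.
  have rN p q (P : 'M[{poly K}]_(p, q)) : rat_mx (- P) = - rat_mx P by exact: map_mxN.
  rewrite /transfer (@transfer_compression _ _ _ _ _ _ (rat_mx (cst_mx U)) _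
    (rat_mx (cst_mx w)) _ _ (rat_mx Ac) (rat_mx Bc) (rat_mx (cst_mx V2)) _
    (rat_mx (cst_mx E))).
  + by rewrite -!rat_mxM -rD eC2 eC3.
  + exact: rat_mx_unit.
  + exact: rat_mx_unit.
  + exact/rat_mx_unit/unitmx_det_neq0.
  + by rewrite -!rat_mxM mulmxA eA2 cst_col_mx cst_mx0 cst_mx1 mul_col_mx !mx_simp.
  + rewrite -!rat_mxM -rB -rat_mxM eA3 -rN -mulmxN.
    by rewrite cst_col_mx cst_mx0 cst_mx1 mul_col_mx !mx_simp.
- have ePC : col_mx A C = pencil (col_mx A1 C1) (col_mx A0 C0) by rewrite pencil_col.
  have ecc : col_mx Ac Cc = pencil (col_mx (Q1' *m T2) (C1 *m V2)) (col_mx (Q0' *m T2) (C0 *m V2)).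
    by rewrite pencil_col -eAc -eC2 -pencil_mulr.
  have injA (w' : 'cV_(r + c)) : A *m w' = 0 -> w' = 0 by apply: det_neq0_mulmx0.
  rewrite ePC ecc => /(no_eigenvalues_full_column_rank (column_injective_col_mx injA)) full.
  apply: full_column_rank_no_eigenvalues.
    apply: column_injective_col_mx => w'; rewrite -eAc; exact: det_neq0_mulmx0.
  have [eA21 eA20] : U *m A1 *m V2 = E *m (Q1' *m T2) /\ U *m A0 *m V2 = E *m (Q0' *m T2).
    apply: pencil_inj; rewrite -pencil_mul -pencil_mull -eAc -/A eA2.
    by rewrite cst_col_mx cst_mx0 cst_mx1 mul_col_mx !mx_simp.
  apply: full_column_rank_restrict eA21 eA20 erefl erefl full; last exact: unitarymx_unit.
  move=> y; rewrite -mulmxA => /(congr1 (mulmx (invmx V))).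
  rewrite mulKmx ?unitarymx_unit // mulmx0 mul_col_mx mul0mx mul1mx => /eqP.
  by rewrite col_mx_eq0 => /andP[_ /eqP].
Qed.

End Deflation.

(** * Existence of the reduction *)
Theorem theorem6 (R : realType) (d m n : nat)
    (A : 'M[{poly R[i]}]_d) (B : 'M[{poly R[i]}]_(d, n))
    (C : 'M[{poly R[i]}]_(m, d)) (D : 'M[{poly R[i]}]_(m, n))
    (G : 'M[{fraction {poly R[i]}}]_(m, n))
    (hG : realizes A B C D G) :
  exists (U V : 'M[R[i]]_d) (W : 'M[R[i]]_(d + n)) (dcb dc : nat)
      (e : (dcb + dc)%N = d)
      (W11 : 'M[R[i]]_dcb) (W13 : 'M[R[i]]_(dcb, n))
      (W31 : 'M[R[i]]_(n, dcb)) (W33 : 'M[R[i]]_n)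
      (X : 'M[{poly R[i]}]_dcb) (Y : 'M[{poly R[i]}]_(dc, dcb))
      (Z : 'M[{poly R[i]}]_(m, dcb))
      (Ac : 'M[{poly R[i]}]_dc) (Bc : 'M[{poly R[i]}]_(dc, n))
      (Cc : 'M[{poly R[i]}]_(m, dc)) (Dc : 'M[{poly R[i]}]_(m, n)),
    let ed := congr1 (addn^~ n) e in
    let em := congr1 (addn^~ m) e in
    [/\ [/\ U \is unitarymx, V \is unitarymx & W \is unitarymx],
        [/\ block_mx (cst_mx U) 0 0 1%:M *m block_mx A (- B) C D
              *m block_mx (cst_mx V) 0 0 1%:M *m cst_mx W
            = castmx (em, ed) (block3_mx X 0    0
                                         Y Ac (- Bc)
                                         Z Cc   Dc),
            W = castmx (ed, ed) (block3_mx W11 0    W13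
                                           0   1%:M 0
                                           W31 0    W33),
            number_of_eigenvalues (row_mx A (- B)) dcb,
            is_pencil X
          & regular X]
      & [/\ same_eigenvalues (row_mx A (- B)) X,
            no_eigenvalues (row_mx Ac (- Bc)),
            realizes Ac Bc Cc Dc (G *m rat_mx (cst_mx W33))
              /\ W33 \in unitmx
          & no_eigenvalues (col_mx A C) -> no_eigenvalues (col_mx Ac Cc)]].
Proof.
case: hG => [[pA pB pC pD regA] <-].
case: pA regA => A1 [A0 ->]; case: pB => B1 [B0 ->]; case: pC => C1 [C0 ->].
case: pD => D1 [D0 ->] regA {A B C D G}.
have injP : row_injective (CPair (row_mx A1 (- B1)) (row_mx A0 (- B0))).
  move=> v; rewrite /= pencil_row mul_mx_row => /eqP; rewrite row_mx_eq0.
  by case/andP=> /eqP + _; apply: det_neq0_mul0mx.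
have [r [X1 [X0 [s eP]]]] := kronecker_splitting injP.
have [/= ed edn] := pequiv_size eP.
(* Both c and the number of columns of the L blocks are computed from the block sizes;
   the L blocks are recast as a c by (c + n) pencil before d is replaced by r + c. *)
set c := sumn _ in ed; have es : sumn (map succn s) = (c + n)%N.
  by apply/eqP; rewrite -(eqn_add2l r) addnA -edn ed.
have [Q1 [Q0 eQ]] : exists Q1 Q0 : 'M[R[i]]_(c, c + n), CPair Q1 Q0 ~~~ L_sum s.
  exists (castmx (erefl, es) (lead (L_sum s))), (castmx (erefl, es) (tail (L_sum s))).
  exact/pequiv_sym/pequiv_cast.
have {}eP := pequiv_trans eP (pequiv_dsum (pequiv_refl _) (pequiv_sym eQ)).
have regX : \det (pencil X1 X0) != 0.
  exact/det_neq0P/(row_injective_sub (pequiv_row_injective eP injP)).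
move: c ed es Q1 Q0 eQ eP => c ed es Q1 Q0 eQ eP; subst d.
have [U [V [W11 [W13 [W31 [W33 [X [Y [Z [Ac [Bc [Cc [Dc [h1 h2 h3]]]]]]]]]]]]]] :=
  deflation C1 C0 D1 D0 regA regX eQ eP.
case: h2 => h21 h22 h23 h24.
exists U, V, (block3_mx W11 0 W13 0 1%:M 0 W31 0 W33), r, c, erefl.
exists W11, W13, W31, W33, X, Y, Z, Ac, Bc, Cc, Dc => /=.
by rewrite !castmx_id.
Qed.
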